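(* Let $(X^{n+1},g^+)$ be a conformally compact Einstein manifold with conformal infinity $(M,[\hat g])$, fix a representative $\hat g$, let $\gamma\in(0,1)$ with $\gamma<\frac n2$, $a=1-2\gamma$, and let $\rho^*$ be the special defining function associated with $\gamma$ and $\hat g$. For each smooth function $f$ on $M$, let $U$ solve the extension problem $$-\operatorname{div}\left((\rho^* )^a\nabla U\right)=0\ \text{ in }(X,g^* ),\qquad U=f\ \text{ on }M,$$ where the derivatives are taken with respect to the metric $g^*=(\rho^* )^2g^+$. Then $$P_\gamma[g^+,\hat g]f=\frac{d_\gamma}{2\gamma}\lim_{\rho^*\to0}(\rho^* )^a\,\partial_{\rho^*}U+f\,Q_\gamma[g^+,\hat g].$$
   Context: $\bar X^{n+1}$ is a compact connected manifold with boundary $M$ (of dimension $n$) and interior $X$. A defining function $\rho$ of $M$ in $X$ satisfies $\rho>0$ in $X$, $\rho=0$ and $d\rho\ne0$ on $M$. $(X,g^+)$ is conformally compact Einstein with conformal infinity $(M,[\hat g])$ if $Ric[g^+]=-ng^+$ and for some defining function $\rho$ the metric $\rho^2g^+$ extends to $\bar X$ with $\rho^2g^+|_M\in[\hat g]$. Given $\hat g$, there is a unique defining function $y$ near $M$ with $g^+=y^{-2}(dy^2+g_y)$ on $M\times(0,\delta)$, where $g_y$ is a family of metrics on $M$ with $g_y|_{y=0}=\hat g$, whose expansion has only even powers of $y$ up to order $n$. Definition of $P_\gamma$ and $Q_\gamma$: for $s=\frac n2+\gamma$ and $f\in C^\infty(M)$, let $u$ be the solution of $-\Delta_{g^+}u-s(n-s)u=0$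 in $X$ of the form $u=Fy^{n-s}+Hy^s$, with $F,H$ smooth up to the boundary, having only even powers of $y$ in their expansions (up to order $n$), and $F|_{y=0}=f$. Put $S(s)f=H|_{y=0}$, $P_\gamma[g^+,\hat g]f:=d_\gamma S\left(\frac n2+\gamma\right)f$ with $d_\gamma=2^{2\gamma}\frac{\Gamma(\gamma)}{\Gamma(-\gamma)}$, and $Q_\gamma[g^+,\hat g]:=P_\gamma[g^+,\hat g](1)$. $\Delta_{g^+}$ is the Laplace–Beltrami operator (with $-\Delta\ge0$). Special defining function: $\rho^*:=v^{1/(n-s)}$, where $s=\frac n2+\gamma$ and $v$ is the solution of $-\Delta_{g^+}v-s(n-s)v=0$ in $X$ of the form $v=\tilde Fy^{n-s}+\tilde Hy^s$, with $\tilde F,\tilde H$ smooth up to the boundary, having only even powers of $y$ in their expansions (up to order $n$), and $\tilde F|_{y=0}\equiv1$; $v$ is positive on $X$, so $\rho^*$ is a positive function on all of $X$, and $\rho^*=y+O(y^{2\gamma+1})$ near $M$. Near $M$, $\partial_{\rho^*}$ is the derivative in $\rho^*$ in the coordinates $(x,\rho^* )$, $x\in M$. Solutions $U$ are continuous up to $M$. Standing assumption: $S(s)$ has no poles in $\operatorname{Re}s>\frac n2$ other than the trivial ones; that is, $-\Delta_{g^+}$ has no $L^2$-eigenvalues in $(0,\frac{n^2}4)$. *)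

(* Defs.v *)
From HB Require Import structures.
From mathcomp Require Import all_boot all_order all_algebra.
From mathcomp Require Import all_classical all_reals all_analysis.

Set Implicit Arguments.
Unset Strict Implicit.
Unset Printing Implicit Defensive.

Import Order.TTheory GRing.Theory Num.Theory.
Import numFieldNormedType.Exports.

Local Open Scope classical_set_scope.
Local Open Scope ring_scope.

(** ** Functions of class C^r on R^m *)

Section Euclidean.
Context {R : realType} {m : nat}.
Implicit Types (h F : 'rV[R]_m -> R) (O D : set 'rV[R]_m).

Definition unitv (i : 'I_m) : 'rV[R]_m := delta_mx 0 i.

Definition iter_partial (l : seq 'I_m) h : 'rV[R]_m -> R :=
  foldr (fun i k => fun z => 'D_(unitv i) k z) h l.

(* The order of differentiability is [Some r] for C^r and [None] for C^oo. *)
Definition upto (r : option nat) (k : nat) : bool :=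
  if r is Some r' then (k <= r')%N else true.

Definition class_Cr (r : option nat) O h : Prop :=
  forall l, upto r (size l) -> forall z, O z ->
    {for z, continuous (iter_partial l h)} /\
    (upto r (size l).+1 -> forall i, derivable (iter_partial l h) z (unitv i)).

(* [F] is a C^r extension of [h] from [D] to the open neighbourhood [O] of [z]. *)
Definition Cr_extension (r : option nat) D h z O F : Prop :=
  [/\ open O, O z, class_Cr r O F & forall w, O w -> D w -> F w = h w].

(* On an arbitrary set (for example, a relatively open subset of a half space)
   differentiability means local extendability; on an open set this is the
   usual notion. *)
Definition Cr_on (r : option nat) D h : Prop :=
  forall z, D z -> exists O F, Cr_extension r D h z O F.

End Euclidean.

(* The expansion of [h] at 0+ has only even powers up to order n. *)
Definition even_expansion (R : realType) (n : nat) (h : R -> R) : Prop :=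
  exists q : {poly R}, (forall i, odd i -> q`_i = 0) /\
    exists C, \forall t \near 0^'+, `|h t - q.[t]| <= C * t ^+ n.

(** ** Manifolds *)

Record chart (R : realType) (T : Type) (m : nat) := Chart {
  cdom : set T ;
  cphi : T -> 'rV[R]_m ;
  cpsi : 'rV[R]_m -> T }.

Section Manifold.
Context {R : realType} {T : topologicalType}.

Section AnyDimension.
Context {m : nat}.
Implicit Types (e k : chart R T m) (A : set (chart R T m)) (S : set T).

Definition cimg e S : set 'rV[R]_m := cphi e @` (cdom e `&` S).

(* [h] is of class C^r on the set of points [S]. *)
Definition Cr_fun (r : option nat) A S (h : T -> R) : Prop :=
  forall e, A e -> Cr_on r (cimg e S) (h \o cpsi e).

(* Partial derivative of [h] in the [i]-th coordinate of [e]. *)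
Definition pd e (i : 'I_m) (h : T -> R) (p : T) : R :=
  'D_(unitv i) (h \o cpsi e) (cphi e p).

(* Entry (i, j) is d x'_j / d x_i, with x (resp. x') the coordinates of [e]
   (resp. [k]); matrices act on row vectors on the right. *)
Definition jac e k (p : T) : 'M[R]_m :=
  \matrix_(i, j) pd e i (fun q => cphi k q 0 j) p.

(* Components in each chart, as functions of the point. *)
Definition bilinear_field := chart R T m -> T -> 'M[R]_m.
Definition vector_field := chart R T m -> T -> 'rV[R]_m.

Definition posdef (G : 'M[R]_m) : Prop :=
  G^T = G /\ forall v : 'rV[R]_m, v != 0 -> 0 < (v *m G *m v^T) 0 0.

Definition smooth_posdef A S (g : bilinear_field) : Prop :=
  forall e, A e ->
    (forall i j, Cr_on None (cimg e S) (fun z => g e (cpsi e z) i j)) /\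
    (forall p, cdom e p -> S p -> posdef (g e p)).

(* [cimg e S] has to be open for the Jacobians below to be meaningful: [S] is
   the interior of a manifold with boundary, or a manifold without boundary. *)
Definition is_metric A S (g : bilinear_field) : Prop :=
  smooth_posdef A S g /\
  forall e k p, A e -> A k -> cdom e p -> cdom k p -> S p ->
    g e p = jac e k p *m g k p *m (jac e k p)^T.

Definition grad (g : bilinear_field) (h : T -> R) : vector_field :=
  fun e p => \row_i \sum_j invmx (g e p) i j * pd e j h p.

Definition divg (g : bilinear_field) (V : vector_field)
    (e : chart R T m) (p : T) : R :=
  (Num.sqrt (\det (g e p)))^-1 *
  \sum_i pd e i (fun q => Num.sqrt (\det (g e q)) * V e q 0 i) p.

Definition laplace (g : bilinear_field) (h : T -> R) := divg g (grad g h).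

Definition christoffel (g : bilinear_field) e (k i j : 'I_m) (p : T) : R :=
  2^-1 * \sum_l invmx (g e p) k l *
    (pd e i (fun q => g e q j l) p + pd e j (fun q => g e q i l) p
     - pd e l (fun q => g e q i j) p).

Definition ricci (g : bilinear_field) : bilinear_field := fun e p =>
  \matrix_(i, j)
    (\sum_k pd e k (christoffel g e k i j) p
     - \sum_k pd e j (christoffel g e k i k) p
     + \sum_k \sum_l christoffel g e k k l p * christoffel g e l i j p
     - \sum_k \sum_l christoffel g e k j l p * christoffel g e l i k p).

Definition box (a b : 'rV[R]_m) : set 'rV[R]_m :=
  [set z | forall i, a 0 i <= z 0 i <= b 0 i].

(* Finitely many pieces: [box (a i) (b i)] lies in the chart [e i] and [mu i] is
   a lower bound on it of the density of [h dvol_g] with respect to Lebesgue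
   measure; the pieces are pairwise disjoint in the manifold. *)
Definition lower_sum_pieces A S (g : bilinear_field) (h : T -> R) (N : nat)
    (e : 'I_N -> chart R T m) (a b : 'I_N -> 'rV[R]_m) (mu : 'I_N -> R) :
    Prop :=
  (forall i : 'I_N,
    [/\ A (e i), forall j, a i 0 j <= b i 0 j,
        box (a i) (b i) `<=` cimg (e i) S,
        0 <= mu i &
        forall z, box (a i) (b i) z ->
          mu i <= h (cpsi (e i) z) *
                  Num.sqrt (\det (g (e i) (cpsi (e i) z)))]) /\
  (forall i j : 'I_N, i != j ->
    (cpsi (e i) @` box (a i) (b i)) `&` (cpsi (e j) @` box (a j) (b j)) = set0).

(* Integral over [S] of a continuous function [h >= 0] against the Riemannian
   volume, as the supremum of its lower Darboux sums. *)
Definition vol_integral A S (g : bilinear_field) (h : T -> R) : \bar R :=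
  ereal_sup [set x | exists (N : nat) (e : 'I_N -> chart R T m)
    (a b : 'I_N -> 'rV[R]_m) (mu : 'I_N -> R),
    lower_sum_pieces A S g h e a b mu /\
    x = (\sum_i mu i * \prod_j (b i 0 j - a i 0 j))%:E].

End AnyDimension.

(* The dimension is n + 1 and charts take values in the half space where the
   0-th coordinate is nonnegative. *)
Section Boundary.
Context {n : nat}.
Implicit Types (e k : chart R T n.+1) (A : set (chart R T n.+1)) (M : set T).

Definition half_space : set 'rV[R]_n.+1 := [set z | 0 <= z 0 ord0].

Definition ctail (z : 'rV[R]_n.+1) : 'rV[R]_n := @rsubmx R 1 1 n z.
Definition ccons (t : R) (x : 'rV[R]_n) : 'rV[R]_n.+1 :=
  @row_mx R 1 1 n t%:M x.

Definition is_chart M e : Prop :=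
  [/\ open (cdom e) /\
      exists2 O, open O & cphi e @` cdom e = O `&` half_space,
      forall p, cdom e p -> cpsi e (cphi e p) = p,
      {within cdom e, continuous (cphi e)},
      {within cphi e @` cdom e, continuous (cpsi e)} &
      forall p, cdom e p -> M p <-> cphi e p 0 ord0 = 0].

Definition compatible e k : Prop := forall j,
  Cr_on None (cimg e (cdom k)) (fun z => cphi k (cpsi e z) 0 j) /\
  Cr_on None (cimg k (cdom e)) (fun z => cphi e (cpsi k z) 0 j).

(* [T] is a compact connected smooth manifold of dimension n + 1 with boundary
   [M], and [A] is its maximal atlas. *)
Definition compact_manifold A M : Prop :=
  [/\ [/\ compact [set: T], hausdorff_space T & connected [set: T]],
      forall p, exists2 e, A e & cdom e p,
      forall e, A e -> is_chart M e,
      forall e k, A e -> A k -> compatible e k &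
      forall e, is_chart M e -> (forall k, A k -> compatible e k) -> A e].

Definition bd_chart M e : chart R T n :=
  Chart (cdom e `&` M) (fun p => ctail (cphi e p))
    (fun x => cpsi e (ccons 0 x)).

Definition bd_atlas A M : set (chart R T n) := bd_chart M @` A.

(* The condition [d rho <> 0] at a boundary point is expressed through a smooth
   extension across the boundary; it does not depend on the extension. *)
Definition defining_function A M (rho : T -> R) : Prop :=
  [/\ Cr_fun None A [set: T] rho,
      forall p, ~ M p -> 0 < rho p,
      forall p, M p -> rho p = 0 &
      forall e p, A e -> cdom e p -> M p -> exists O F,
        Cr_extension None (cimg e [set: T]) (rho \o cpsi e) (cphi e p) O F /\
        exists i, 'D_(unitv i) F (cphi e p) != 0].

Definition bfield := @bilinear_field n.+1.
Definition bd_bfield := @bilinear_field n.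

Definition einstein A M (g : bfield) : Prop :=
  forall e p, A e -> cdom e p -> ~ M p -> ricci g e p = - n%:R *: g e p.

(* (X, g) is conformally compact Einstein, X = ~` M, with conformal infinity
   (M, [gh]). *)
Definition conformally_compact_einstein A M (g : bfield) (gh : bd_bfield) :
    Prop :=
  [/\ is_metric A (~` M) g,
      is_metric (bd_atlas A M) M gh,
      einstein A M g &
      exists (rho : T -> R) (gbar : bfield) (lam : T -> R),
      [/\ defining_function A M rho,
          smooth_posdef A [set: T] gbar,
          forall e p, A e -> cdom e p -> ~ M p ->
            gbar e p = rho p ^+ 2 *: g e p,
          Cr_fun None (bd_atlas A M) M lam /\ (forall p, M p -> 0 < lam p) &
          forall e p, A e -> cdom e p -> M p ->
            @drsubmx R 1 n 1 n (gbar e p) = lam p *: gh (bd_chart M e) p]].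

(* No L^2-eigenvalue of [- Delta_g] on X = ~` M lies in (0, n^2 / 4). *)
Definition no_small_eigenvalue A M (g : bfield) : Prop :=
  forall lam : R, 0 < lam < n%:R ^+ 2 / 4 ->
  forall h : T -> R, Cr_fun (Some 2%N) A (~` M) h ->
    (forall e p, A e -> cdom e p -> ~ M p -> - laplace g h e p = lam * h p) ->
    (vol_integral A (~` M) g (fun p => (h p ^+ 2)%R) < +oo)%E ->
    forall p, ~ M p -> h p = 0.

Definition collar M (c : T -> R -> T) (S : set T) (delta : R) : set T :=
  [set q | exists p t, [/\ M p, S p, 0 <= t < delta & q = c p t]].

(* [c] is a diffeomorphism (p, t) |-> c p t from M x [0, delta) onto a
   neighbourhood of M, on which y (c p t) = t and
   g = y^-2 (dy^2 + g_y) with g_0 = gh.  The diffeomorphism property is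
   expressed by the fact that every chart [e] yields a chart [k] of the smooth
   structure with coordinates (t, x), x being the coordinates of [e] on M. *)
Definition geodesic_defining A M (g : bfield) (gh : bd_bfield)
    (y : T -> R) (delta : R) (c : T -> R -> T) : Prop :=
  0 < delta /\
  [/\ forall p, M p -> c p 0 = p,
      forall p q t, M p -> M q -> 0 <= t < delta -> c p t = c q t -> p = q,
      forall p t, M p -> 0 <= t < delta -> y (c p t) = t &
      exists gy : R -> bd_bfield,
      [/\ forall t, 0 <= t < delta -> is_metric (bd_atlas A M) M (gy t),
          forall e p, A e -> cdom e p -> M p ->
            gy 0 (bd_chart M e) p = gh (bd_chart M e) p,
          forall e i j, A e ->
            Cr_on None
              [set z : 'rV[R]_n.+1 | 0 <= z 0 ord0 < delta /\
                       cimg (bd_chart M e) [set: T] (ctail z)]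
              (fun z => gy (z 0 ord0) (bd_chart M e)
                           (cpsi e (ccons 0 (ctail z))) i j) /\
            forall p, cdom e p -> M p ->
              even_expansion n (fun t => gy t (bd_chart M e) p i j) &
          forall e, A e -> exists2 k, A k &
            [/\ cdom k = collar M c (cdom e) delta,
                forall p t, cdom e p -> M p -> 0 <= t < delta ->
                  cphi k (c p t) = ccons t (ctail (cphi e p)) &
                forall p t, cdom e p -> M p -> 0 < t < delta ->
                  g k (c p t) =
                    t ^- 2 *: @block_mx R 1 n 1 n 1%:M 0 0
                                (gy t (bd_chart M e) p)]]].

(* [u] solves - Delta_g u - s (n - s) u = 0 in X = ~` M and, near M,
   u = F y^(n-s) + H y^s with F, H smooth up to M and even up to order n,
   and F = f on M. *)
Definition scattering_solution A M (g : bfield) (y : T -> R) (delta : R)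
    (c : T -> R -> T) (s : R) (f u H : T -> R) : Prop :=
  [/\ Cr_fun (Some 2%N) A (~` M) u,
      forall e p, A e -> cdom e p -> ~ M p ->
        - laplace g u e p - s * (n%:R - s) * u p = 0 &
      exists (F : T -> R) (eps : R), [/\ 0 < eps <= delta,
        Cr_fun None A (collar M c [set: T] eps) F /\
        Cr_fun None A (collar M c [set: T] eps) H,
        forall p, M p -> even_expansion n (fun t => F (c p t)) /\
                         even_expansion n (fun t => H (c p t)),
        forall p, M p -> F p = f p &
        forall q, collar M c [set: T] eps q -> ~ M q ->
          u q = F q * y q `^ (n%:R - s) + H q * y q `^ s]].

(* [Sf] is S(s) f as a function on M. *)
Definition is_scattering A M g y delta c (s : R) (f Sf : T -> R) : Prop :=
  exists u H, scattering_solution A M g y delta c s f u H /\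
    forall p, M p -> Sf p = H p.

End Boundary.

End Manifold.

Section Operators.
Context {R : realType}.

(* Euler's limit formula, valid for every real z other than 0, -1, -2, ... *)
Definition Gamma (z : R) : R :=
  limn (fun k : nat =>
    k`!%:R * k%:R `^ z / \prod_(0 <= i < k.+1) (z + i%:R)).

Definition d_ (gamma : R) : R :=
  2 `^ (2 * gamma) * (Gamma gamma / Gamma (- gamma)).

Context {T : topologicalType} {n : nat}.
Implicit Types (A : set (chart R T n.+1)) (M : set T).

(* [Pf] is P_gamma[g, gh] f as a function on M; [gh] enters through [y]. *)
Definition is_P A M g y delta c (gamma : R) (f Pf : T -> R) : Prop :=
  exists2 Sf, is_scattering A M g y delta c (n%:R / 2 + gamma) f Sf &
    forall p, M p -> Pf p = d_ gamma * Sf p.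

Definition is_Q A M g y delta c (gamma : R) (Q : T -> R) : Prop :=
  is_P A M g y delta c gamma (fun=> 1) Q.

(* Only the values of [rho] on the interior X = ~` M are specified. *)
Definition special_defining A M g y delta c (gamma : R) (rho : T -> R) : Prop :=
  let s := n%:R / 2 + gamma in
  exists v H, [/\ scattering_solution A M g y delta c s (fun=> 1) v H,
    forall p, ~ M p -> 0 < v p &
    forall p, ~ M p -> rho p = v p `^ (n%:R - s)^-1].

Definition conformal_metric (rho : T -> R) (g : @bfield R T n) : @bfield R T n :=
  fun e p => rho p ^+ 2 *: g e p.

(* - div (rho^a grad U) = 0 in (X, rho^2 g), U = f on M. *)
Definition extension_solution A M (g : @bfield R T n) (rho : T -> R) (a : R)
    (f U : T -> R) : Prop :=
  let gs := conformal_metric rho g in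
  [/\ Cr_fun (Some 2%N) A (~` M) U,
      continuous U,
      forall e p, A e -> cdom e p -> ~ M p ->
        - divg gs (fun k q => rho q `^ a *: grad gs U k q) e p = 0 &
      forall p, M p -> U p = f p].

(* The point with coordinates (p, r) in the system (x, rho) near M, i.e. the
   point of the collar line through p at which rho takes the value r; it is
   unique for small r > 0. *)
Definition rho_point (delta : R) (c : T -> R -> T) (rho : T -> R)
    (p : T) (r : R) : T :=
  xget p [set q | exists2 t, 0 < t < delta & q = c p t /\ rho q = r].

Definition along_rho (delta : R) (c : T -> R -> T) (rho U : T -> R) (p : T) :
    R -> R :=
  fun r => U (rho_point delta c rho p r).

End Operators.

(* Main.v *)
Require Import Defs.
From mathcomp Require Import all_boot all_order all_algebra.
From mathcomp Require Import all_classical all_reals all_analysis.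
From mathcomp Require Import ring lra.

Import Order.TTheory GRing.Theory Num.Theory.
Import numFieldNormedType.Exports.

(** The function U is a quotient of scattering solutions, and the formula is
    read off from their expansions at the boundary.

    Let v be the solution with boundary value 1 that defines rho, and u the one
    with boundary value f. In the metric rho^2 g the volume density, the inverse
    metric and the weight rho^a contribute the powers n + 1, -2 and a of rho,
    hence together rho^(2(n-s)) = v^2 ([conformal_divg]): the extension equation
    is div(v^2 grad U) = 0 for the metric g. As v^2 grad(u/v) =
    v grad u - u grad v and u, v solve the same eigenvalue equation, u/v is a
    solution too ([divop_quotient]). Near the boundary
      u/v = (F + H y^(2 gamma)) / (F1 + K y^(2 gamma))
    extends continuously by f, so U - u/v extends by 0. The equation has no zero
    order term, so the maximum principle gives U = u/v ([extension_ratio]): it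
    combines Hopf's strong maximum principle in a chart ([strong_maximum]) with
    the connectedness of the manifold ([maximum_principle]).

    Along a collar line with parameter t, t^a times the derivative of
    F + H t^(2 gamma) tends to 2 gamma H(0). The contribution t^a F' vanishes in
    the limit because F is even up to order n, so F' = O(t) when n > 1, while
    gamma < 1/2 when n = 1 ([singular_profile]). Therefore t^a dU/dt tends to
    2 gamma (H - f K) ([ratio_profile]). Since rho is asymptotic to t with its
    first derivative, and rho is bounded below away from the boundary, for small
    r there is exactly one point of the line with rho = r and the same limit holds in
    the variable rho ([change_of_variable], [along_rho_limit]).

    Multiplying by d_gamma / (2 gamma) gives P f - f Q, provided that the
    coefficient K of v is the one which enters Q, possibly through another
    solution v' with boundary value 1. Now v'/v = 1, again by uniqueness, so the
    limit for this quotient, which is 2 gamma (K' - K), is 0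
    ([scattering_unique]). *)

Local Open Scope classical_set_scope.
Local Open Scope ring_scope.

(** * Functions with continuous partial derivatives *)

Section Ck.
Context {R : realType} {m : nat}.
Implicit Types (D O : set 'rV[R]_m) (h k : 'rV[R]_m -> R).

(** Class C^r in the form that supports induction on [r]: the partial
    derivatives exist and are of class C^(r-1). *)
Fixpoint ck (r : nat) D h : Prop :=
  (forall z, D z -> {for z, continuous h}) /\
  (if r is r'.+1 then
     forall i, (forall z, D z -> derivable h z (unitv i)) /\
               ck r' D (fun z => 'D_(unitv i) h z)
   else True).

Lemma ck_cont r D h z : ck r D h -> D z -> {for z, continuous h}.
Proof. by case: r => [|r] [H _]; exact: H. Qed.

Lemma ck_derivable r D h z i : ck r.+1 D h -> D z -> derivable h z (unitv i).
Proof. by move=> [_ /(_ i)[H _]]; exact: H. Qed.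

Lemma ck_partial r D h i : ck r.+1 D h -> ck r D (fun z => 'D_(unitv i) h z).
Proof. by move=> [_ /(_ i)[_ H]]. Qed.

Lemma ckW r D h : ck r.+1 D h -> ck r D h.
Proof.
elim: r h => [|r IH] h; first by case.
move=> hr; split; first by move=> z; exact: (ck_cont _ _ _ _ hr).
move=> i; split; first by move=> z; exact: (ck_derivable _ _ _ _ _ hr).
exact/IH/ck_partial.
Qed.

(** Derivatives only depend on the values near a point, so that on an open set
    local extendability to a C^r function is differentiability. *)
Lemma ck_local r D h : open D ->
  (forall z, D z -> exists V k,
     [/\ open V, V z, ck r V k & forall w, V w -> D w -> k w = h w]) ->
  ck r D h.
Proof.
move=> oD H.
have near_kh (k q : 'rV[R]_m -> R) z V : open V -> V z -> D z ->
    (forall w, V w -> D w -> k w = q w) -> \forall w \near z, k w = q w.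
  move=> oV Vz Dz kh.
  have oVD : nbhs z (V `&` D) by apply: open_nbhs_nbhs; split=> //; exact: openI.
  by apply: filterS oVD => w [/kh]; exact.
have cont q r' : (forall z, D z -> exists V k,
     [/\ open V, V z, ck r' V k & forall w, V w -> D w -> k w = q w]) ->
    forall z, D z -> {for z, continuous q}.
  move=> {}H z /[dup] Dz /H [V [k [oV Vz kV kh]]].
  have nkh := near_kh _ _ _ _ oV Vz Dz kh.
  have : k @ z --> k z by exact: ck_cont _ _ _ _ kV Vz.
  rewrite (nbhs_singleton nkh) => kz; apply: cvg_trans kz.
  exact: (near_eq_cvg nkh).
elim: r h H => [|r IH] h H; split=> //; try exact: cont H.
move=> i; split.
  move=> z /[dup] Dz /H [V [k [oV Vz kV kh]]].
  apply: near_eq_derivable (near_kh _ _ _ _ oV Vz Dz kh) _.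
  exact: (ck_derivable _ _ _ _ _ kV).
apply: IH => z /[dup] Dz /H [V [k [oV Vz kV kh]]].
exists V, (fun z => 'D_(unitv i) k z); split=> //; first exact: ck_partial.
by move=> w Vw Dw; apply: near_eq_derive; exact: near_kh oV Vw Dw kh.
Qed.

Lemma ck_eq r D h k : open D -> (forall z, D z -> h z = k z) ->
  ck r D h -> ck r D k.
Proof.
move=> oD hk hD; apply: (ck_local _ _ _ oD) => z Dz.
by exists D, h; split=> // w _ /hk.
Qed.

Lemma class_Cr_ck ro r O h : upto ro r -> class_Cr ro O h -> ck r O h.
Proof.
move=> ror hO.
suff main q l : upto ro (size l + q)%N -> ck q O (iter_partial l h).
  exact: (main r [::]).
elim: q l => [|q IH] l rol.
  by rewrite addn0 in rol; split=> // z /(hO _ rol)[].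
have rolq : upto ro (size l).+1.
  case: ro rol {ror hO IH} => //= ro; rewrite addnS; apply: leq_trans.
  by rewrite ltnS leq_addr.
have rol0 : upto ro (size l) by case: ro rolq {ror hO IH rol} => //= ro /ltnW.
split; first by move=> z /(hO _ rol0)[].
move=> i; split; first by move=> z /(hO _ rol0)[_ /(_ rolq)].
by apply: (IH (i :: l)); rewrite /= addSnnS.
Qed.

Lemma Cr_on_ck ro r D h : open D -> upto ro r -> Cr_on ro D h -> ck r D h.
Proof.
move=> oD ror hD; apply: ck_local => // z /hD [V [k [oO Oz kO kh]]].
by exists V, k; split=> //; exact: class_Cr_ck kO.
Qed.

Lemma is_derive_line h (z v : 'rV[R]_m) (t d : R) :
  is_derive t 1 (fun t : R => h (t *: v + z)) d <-> is_derive (t *: v + z) v h d.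
Proof.
have E : (fun s : R => s^-1 *: ((((fun t => h (t *: v + z)) \o shift t) (s *: 1)
      - h (t *: v + z)) : R)) =
    (fun s => s^-1 *: (((h \o shift (t *: v + z)) (s *: v) - h (t *: v + z)) : R)).
  by apply/funext => s /=; rewrite [_%:A]mulr1 scalerDl addrA.
split=> -[ex val]; split.
- by move: ex; rewrite /derivable E.
- by move: val; rewrite /derive E.
- by move: ex; rewrite /derivable -E.
- by move: val; rewrite /derive -E.
Qed.

Lemma derive_comp_scal (phi : R -> R) h (z v : 'rV[R]_m) (d : R) : derivable h z v ->
  is_derive (h z) 1 phi d -> is_derive z v (phi \o h) (d * 'D_v h z).
Proof.
move=> hz dphi.
have ez : 0 *: v + z = z by rewrite scale0r add0r.
have d1 : is_derive (0 : R) 1 (fun t : R => h (t *: v + z)) ('D_v h z).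
  by apply/is_derive_line; rewrite ez.
have dphi' : is_derive (h (0 *: v + z)) 1 phi d by rewrite ez.
have := @is_derive1_comp _ phi (fun t : R => h (t *: v + z)) 0 _ _ dphi' d1.
by move=> /(is_derive_line (phi \o h)); rewrite ez.
Qed.

Lemma is_derive_sumf (I : Type) (s : seq I) (k : I -> 'rV[R]_m -> R)
    (d : I -> R) (z v : 'rV[R]_m) : (forall i, is_derive z v (k i) (d i)) ->
  is_derive z v (fun w => \sum_(i <- s) k i w) (\sum_(i <- s) d i).
Proof.
move=> kd; elim: s => [|i s IH].
  rewrite big_nil (_ : (fun w => _) = cst 0); first exact: is_derive_cst.
  by apply/funext => w; rewrite big_nil.
rewrite big_cons (_ : (fun w => _) = k i + (fun w => \sum_(i <- s) k i w)).
  exact: is_deriveD.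
by apply/funext => w; rewrite big_cons.
Qed.

Lemma is_deriveMf h k (z v : 'rV[R]_m) (a b : R) :
  is_derive z v h a -> is_derive z v k b ->
  is_derive z v (fun w => h w * k w) (a * k z + h z * b).
Proof. by move=> ha kb; rewrite addrC [a * _]mulrC; exact: is_deriveM. Qed.

Lemma ck_cst r D (c : R) : ck r D (fun=> c).
Proof.
elim: r c => [|r IH] c; split=> //; try by move=> z _; exact: cst_continuous.
move=> i; split; first by move=> z _; exact: derivable_cst.
rewrite (_ : (fun z => _) = fun=> 0 : R); first exact: (IH 0).
by apply/funext => z; exact: derive_cst.
Qed.

Lemma ckD r D h k : open D -> ck r D h -> ck r D k ->
  ck r D (fun z => h z + k z).
Proof.
move=> oD; elim: r h k => [|r IH] h k hD kD; split=> //;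
  try by move=> z Dz; apply: continuousD; [exact: ck_cont hD Dz|exact: ck_cont kD Dz].
move=> i; split.
  by move=> z Dz; apply: derivableD; [exact: ck_derivable hD Dz|exact: ck_derivable kD Dz].
apply: ck_eq oD _ (IH _ _ (ck_partial _ _ _ i hD) (ck_partial _ _ _ i kD)).
move=> z Dz; apply/esym/deriveD;
  [exact: ck_derivable hD Dz|exact: ck_derivable kD Dz].
Qed.

Lemma ckM r D h k : open D -> ck r D h -> ck r D k ->
  ck r D (fun z => h z * k z).
Proof.
move=> oD; elim: r h k => [|r IH] h k hD kD; split=> //;
  try by move=> z Dz; apply: continuousM; [exact: ck_cont hD Dz|exact: ck_cont kD Dz].
move=> i; split.
  by move=> z Dz; apply: derivableM; [exact: ck_derivable hD Dz|exact: ck_derivable kD Dz].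
apply: ck_eq oD _ (ckD _ _ _ _ oD (IH _ _ (ckW _ _ _ hD) (ck_partial _ _ _ i kD))
  (IH _ _ (ckW _ _ _ kD) (ck_partial _ _ _ i hD))).
move=> z Dz; apply/esym/deriveM;
  [exact: ck_derivable hD Dz|exact: ck_derivable kD Dz].
Qed.

Lemma ckN r D h : open D -> ck r D h -> ck r D (fun z => - h z).
Proof.
move=> oD hD; apply: ck_eq oD _ (ckM _ _ _ _ oD (ck_cst r D (-1)) hD).
by move=> z _; rewrite mulN1r.
Qed.

Lemma ckB r D h k : open D -> ck r D h -> ck r D k ->
  ck r D (fun z => h z - k z).
Proof. by move=> oD hD kD; apply: ckD oD hD (ckN _ _ _ oD kD). Qed.

Lemma ckV r D h : open D -> (forall z, D z -> h z != 0) -> ck r D h ->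
  ck r D (fun z => (h z)^-1).
Proof.
move=> oD h0; elim: r => [|r IH] hD; split=> //;
  try by move=> z Dz; apply: continuousV; [exact: h0|exact: ck_cont hD Dz].
move=> i; split.
  by move=> z Dz; apply: derivableV; [exact: h0|exact: ck_derivable hD Dz].
have Vr := IH (ckW _ _ _ hD).
apply: ck_eq oD _
  (ckM _ _ _ _ oD (ckN _ _ _ oD (ckM _ _ _ _ oD Vr Vr)) (ck_partial _ _ _ i hD)).
move=> z Dz; rewrite deriveV; [|exact: h0|exact: ck_derivable hD Dz].
by rewrite -invfM -expr2.
Qed.

Lemma ck_sqrt r D h : open D -> (forall z, D z -> 0 < h z) -> ck r D h ->
  ck r D (fun z => Num.sqrt (h z)).
Proof.
move=> oD h0; elim: r => [|r IH] hD.
  by split=> // z Dz; apply: continuous_comp; [exact: ck_cont hD Dz|exact: sqrt_continuous].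
have Dsqrt z i : D z -> is_derive z (unitv i) (Num.sqrt \o h)
    ((2 * Num.sqrt (h z))^-1 * 'D_(unitv i) h z).
  move=> Dz; apply: derive_comp_scal; first exact: ck_derivable hD Dz.
  exact/is_derive1_sqrt/h0.
split.
  by move=> z Dz; apply: continuous_comp; [exact: ck_cont hD Dz|exact: sqrt_continuous].
move=> i; split.
  by move=> z Dz; exact: (@ex_derive _ _ _ _ _ _ _ (Dsqrt z i Dz)).
have s0 z : D z -> 2 * Num.sqrt (h z) != 0.
  by move=> Dz; rewrite mulf_neq0// gt_eqF// sqrtr_gt0 h0.
apply: ck_eq oD _ (ckM _ _ _ _ oD (ckV _ _ _ oD s0
  (ckM _ _ _ _ oD (ck_cst r D 2) (IH (ckW _ _ _ hD)))) (ck_partial _ _ _ i hD)).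
by move=> z Dz; rewrite -(@derive_val _ _ _ _ _ _ _ (Dsqrt z i Dz)).
Qed.

Lemma ck_sum r D (I : Type) (s : seq I) (P : pred I) (h : I -> 'rV[R]_m -> R) :
  open D -> (forall i, ck r D (h i)) ->
  ck r D (fun z => \sum_(i <- s | P i) h i z).
Proof.
move=> oD hD; elim: s => [|i s IH].
  by apply: ck_eq oD _ (ck_cst r D 0) => z _; rewrite big_nil.
case Pi : (P i).
  by apply: ck_eq oD _ (ckD _ _ _ _ oD (hD i) IH) => z _; rewrite big_cons Pi.
by apply: ck_eq oD _ IH => z _; rewrite big_cons Pi.
Qed.

Lemma ck_prod r D (I : Type) (s : seq I) (P : pred I) (h : I -> 'rV[R]_m -> R) :
  open D -> (forall i, ck r D (h i)) ->
  ck r D (fun z => \prod_(i <- s | P i) h i z).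
Proof.
move=> oD hD; elim: s => [|i s IH].
  by apply: ck_eq oD _ (ck_cst r D 1) => z _; rewrite big_nil.
case Pi : (P i).
  by apply: ck_eq oD _ (ckM _ _ _ _ oD (hD i) IH) => z _; rewrite big_cons Pi.
by apply: ck_eq oD _ IH => z _; rewrite big_cons Pi.
Qed.

Lemma ck_det r D (p : nat) (G : 'rV[R]_m -> 'M[R]_p) : open D ->
  (forall i j, ck r D (fun z => G z i j)) -> ck r D (fun z => \det (G z)).
Proof.
move=> oD hD; apply: ck_sum => // s; apply: ckM => //; first exact: ck_cst.
exact: ck_prod.
Qed.

Lemma ck_invmx r D (p : nat) (G : 'rV[R]_m -> 'M[R]_p) : open D ->
  (forall z, D z -> G z \in unitmx) ->
  (forall i j, ck r D (fun z => G z i j)) ->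
  forall i j, ck r D (fun z => invmx (G z) i j).
Proof.
move=> oD GU hD i j.
have dG z : D z -> \det (G z) != 0 by move=> /GU; rewrite unitmxE unitfE.
have adjD : ck r D (fun z => cofactor (G z) j i).
  apply: ckM => //; first exact: ck_cst.
  apply: ck_det => // i' j'; apply: ck_eq oD _ (hD (lift j i') (lift i j')).
  by move=> z _; rewrite !mxE.
apply: ck_eq oD _ (ckM _ _ _ _ oD (ckV _ _ _ oD dG (ck_det _ _ _ _ oD hD)) adjD).
by move=> z Dz; rewrite /invmx GU// !mxE.
Qed.

Lemma is_derive_coord (z : 'rV[R]_m) (v : 'rV[R]_m) (j : 'I_m) :
  is_derive z v (fun w : 'rV[R]_m => w 0 j) (v 0 j).
Proof.
have dc : differentiable (fun w : 'rV[R]_m => w 0 j : R) z.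
  exact: differentiable_coord.
split; first exact: diff_derivable.
suff H : (fun t : R => t^-1 *: ((t *: v + z) 0 j - z 0 j : R)) @ 0^' --> v 0 j.
  exact: cvg_lim H.
have H : cst (v 0 j) t @[t --> (0 : R)^'] --> v 0 j by exact: cvg_cst.
apply: cvg_trans H; apply: near_eq_cvg; near=> t => /=.
rewrite !mxE addrK [_ *: _]mulrA mulVf ?mul1r//.
by near: t; exact: nbhs_dnbhs_neq.
Unshelve. all: by end_near. Qed.

Lemma ck_coord r D (j : 'I_m) : open D -> ck r D (fun z => z 0 j).
Proof.
move=> oD.
have c0 z : {for z, continuous (fun z : 'rV[R]_m => z 0 j)} by exact: coord_continuous.
case: r => [|r]; split=> // i; split.
  by move=> z _; exact: (@ex_derive _ _ _ _ _ _ _ (is_derive_coord z (unitv i) j)).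
apply: ck_eq oD _ (ck_cst r D (unitv i 0 j)) => z _.
by rewrite (@derive_val _ _ _ _ _ _ _ (is_derive_coord z (unitv i) j)).
Qed.

End Ck.

(** * Positive definite matrices *)

Section PosDef.
Context {R : realType}.

Definition qform {m : nat} (G : 'M[R]_m) (v : 'rV[R]_m) : R :=
  (v *m G *m v^T) 0 0.

(** Cholesky factorization. With G = [[a, w], [w^T, G']], the Schur complement
    G' - a^-1 w^T w is again positive definite because completing the square
    identifies its values with values of the form G. *)
Lemma posdef_cholesky (m : nat) (G : 'M[R]_m) : posdef G ->
  exists L : 'M[R]_m, G = L *m L^T.
Proof.
elim: m G => [|m IH] G [Gsym Gpos].
  by exists 0; apply/matrixP => -[].
rewrite -[m.+1]/(1 + m)%N in G Gsym Gpos *.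
pose a : R := ulsubmx G 0 0; pose w := ursubmx G; pose G' := drsubmx G.
have GE : G = block_mx a%:M w w^T G'.
  rewrite -[LHS]submxK /w trmx_ursub Gsym; congr block_mx.
  by rewrite [LHS]mx11_scalar.
have G'sym : G'^T = G' by rewrite /G' trmx_drsub Gsym.
have a0 : 0 < a.
  have /Gpos : row_mx 1 0 != 0 :> 'rV[R]_(1 + m).
    apply/eqP => /(congr1 lsubmx); rewrite row_mxKl => /matrixP/(_ 0 0).
    by rewrite !mxE => /eqP; rewrite oner_eq0.
  rewrite GE mul_row_block tr_row_mx mul_row_col !trmx0 mulmx0 addr0 mul1mx.
  by rewrite mul0mx addr0 trmx1 mulmx1 mxE eqxx.
have aN0 : a != 0 by rewrite gt_eqF.
pose S := G' - a^-1 *: (w^T *m w).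
have Spos : posdef S.
  split; first by rewrite /S linearB linearZ /= trmx_mul trmxK G'sym.
  move=> x x0; pose y : 'M[R]_1 := - a^-1 *: (x *m w^T).
  have /Gpos : row_mx y x != 0.
    by apply: contra_neq x0 => /(congr1 rsubmx); rewrite row_mxKr linear0.
  rewrite GE mul_row_block tr_row_mx mul_row_col.
  have -> : y *m a%:M + x *m w^T = 0.
    by rewrite mul_mx_scalar scalerA mulrN divff// scaleN1r addNr.
  rewrite mul0mx add0r /y -scalemxAl -mulmxA mulmxDl -!scalemxAl.
  by rewrite /S mulmxBr mulmxBl -scalemxAr -scalemxAl !mulmxA scaleNr addrC.
have [L' SE] := IH _ Spos.
pose s := Num.sqrt a.
have s0 : s != 0 by rewrite gt_eqF// sqrtr_gt0.
have ss : s * s = a by rewrite -expr2 sqr_sqrtr// ltW.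
exists (block_mx s%:M 0 (s^-1 *: w^T) L').
rewrite GE tr_block_mx mulmx_block !trmx0 !mulmx0 !mul0mx tr_scalar_mx.
rewrite linearZ /= trmxK !addr0 -scalar_mxM ss.
rewrite -SE mul_scalar_mx mul_mx_scalar !scalerA divff// !scale1r.
rewrite -scalemxAl -scalemxAr scalerA -invfM ss /S addrC subrK.
by [].
Qed.

Lemma posdef_unit (m : nat) (G : 'M[R]_m) : posdef G -> G \in unitmx.
Proof.
move=> [_ Gpos]; rewrite -row_free_unit -kermx_eq0; apply/eqP/row_matrixP => i.
rewrite row0; apply/eqP/negPn/negP => /Gpos.
have /sub_kermxP -> : (row i (kermx G) <= kermx G)%MS by exact: row_sub.
by rewrite mul0mx mxE ltxx.
Qed.

Lemma posdef_det (m : nat) (G : 'M[R]_m) : posdef G -> 0 < \det G.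
Proof.
move=> Gp; rewrite lt_def -unitfE -unitmxE posdef_unit//=.
have [L ->] := posdef_cholesky _ _ Gp.
by rewrite det_mulmx det_tr -expr2 sqr_ge0.
Qed.

Lemma posdef_scale (m : nat) (G : 'M[R]_m) (b : R) : 0 < b -> posdef G ->
  posdef (b *: G).
Proof.
move=> b0 [Gsym Gpos]; split; first by rewrite linearZ /= Gsym.
by move=> v /Gpos v0; rewrite -scalemxAr -scalemxAl mxE mulr_gt0.
Qed.

Lemma posdef_inv (m : nat) (G : 'M[R]_m) : posdef G -> posdef (invmx G).
Proof.
move=> Gp; have GU := posdef_unit _ _ Gp; have [Gsym Gpos] := Gp.
split; first by rewrite trmx_inv Gsym.
move=> v v0; have /Gpos : v *m invmx G != 0.
  by apply: contra_neq v0 => v0; rewrite -[v](mulmxKV GU) v0 mul0mx.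
by rewrite mulmxKV// trmx_mul trmx_inv Gsym mulmxA.
Qed.

(** Writing B = L L^T, the contraction is the sum over the columns l of L of the
    values H(l, l). *)
Lemma posdef_contract_le0 (m : nat) (B H : 'M[R]_m) : posdef B ->
  (forall v : 'rV[R]_m, \sum_i \sum_j v 0 i * v 0 j * H i j <= 0) ->
  \sum_i \sum_j B i j * H i j <= 0.
Proof.
move=> /posdef_cholesky[L ->] Hneg.
rewrite (_ : \sum_i _ = \sum_i \sum_j \sum_k (L i k * L j k) * H i j); last first.
  apply: eq_bigr => i _; apply: eq_bigr => j _; rewrite mxE mulr_suml.
  by apply: eq_bigr => k _; rewrite !mxE.
under eq_bigr do rewrite exchange_big /=.
rewrite exchange_big /=.
apply: sumr_le0 => k _.
apply: le_trans (Hneg (\row_i L i k)); rewrite le_eqVlt; apply/orP; left.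
by apply/eqP; apply: eq_bigr => i _; apply: eq_bigr => j _; rewrite !mxE.
Qed.

End PosDef.

(** * First and second order conditions at a maximum *)

Section Maximum.
Context {R : realType} {m : nat}.
Implicit Types (D : set 'rV[R]_m) (h : 'rV[R]_m -> R).

Lemma is_derive_cvg h (z v : 'rV[R]_m) (d : R) :
  (fun t : R => t^-1 *: (h (t *: v + z) - h z)) @ 0^' --> d ->
  is_derive z v h d.
Proof.
by move=> H; split; [apply/cvg_ex; exists d; exact: H|exact: cvg_lim H].
Qed.

Lemma cvg_is_derive h (z v : 'rV[R]_m) (d : R) : is_derive z v h d ->
  (fun t : R => t^-1 *: (h (t *: v + z) - h z)) @ 0^' --> d.
Proof. by case=> /[swap] <-. Qed.

Lemma mvt_unitv h (w : 'rV[R]_m) (k : 'I_m) (tau : R) :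
  (forall s : R, 0 <= s <= 1 -> derivable h ((s * tau) *: unitv k + w) (unitv k)) ->
  exists2 s : R, 0 <= s <= 1 &
    h (tau *: unitv k + w) - h w = tau * 'D_(unitv k) h ((s * tau) *: unitv k + w).
Proof.
move=> dh.
pose psi (s : R) := h ((s * tau) *: unitv k + w).
have dpsi (s : R) : 0 <= s <= 1 -> is_derive s 1 psi
    ('D_(unitv k) h ((s * tau) *: unitv k + w) * tau).
  move=> s01; have /derivableP d1 := dh _ s01.
  have /is_derive_line d2 := d1.
  have d3 : is_derive s 1 (fun s => s * tau) tau.
    have := @is_deriveM _ _ id (cst tau) s 1 1 0 _ _.
    by rewrite scaler0 add0r [_ *: _]mulr1; exact.
  exact: (@is_derive1_comp _ (fun t => h (t *: unitv k + w)) (fun s => s * tau)).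
have [||c] := @MVT R psi
    (fun s => 'D_(unitv k) h ((s * tau) *: unitv k + w) * tau) 0 1 ltr01.
- by move=> s sI; apply: dpsi; move: sI; rewrite in_itv /= => /andP[/ltW-> /ltW->].
- apply: derivable_within_continuous => s; rewrite in_itv /= => s01.
  by have [] := dpsi s s01.
rewrite in_itv /= => /andP[c0 c1]; rewrite /psi mul1r mul0r scale0r add0r.
by rewrite subr0 mulr1 => E; exists c; [rewrite !ltW|rewrite E mulrC].
Qed.

Lemma is_derive_add_unitv D h (z l : 'rV[R]_m) (k : 'I_m) (c d : R) :
  open D -> ck 1 D h -> D z ->
  is_derive z l h d ->
  is_derive z (c *: unitv k + l) h (c * 'D_(unitv k) h z + d).
Proof.
move=> oD hD Dz /cvg_is_derive dl; apply: is_derive_cvg.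
rewrite (_ : (fun t => _) = (fun t : R => t^-1 *: (h ((t * c) *: unitv k + (t *: l + z)) - h (t *: l + z))) \+
   (fun t : R => t^-1 *: (h (t *: l + z) - h z))); last first.
  apply/funext => t /=; rewrite -scalerDr; congr (_ *: _).
  rewrite [RHS]addrA subrK; congr (h _ - _).
  by rewrite scalerDr scalerA addrA.
apply: cvgD dl.
apply/cvgrPdist_le => e e0.
pose e' := e / (1 + `|c|).
have c1 : 0 < 1 + `|c| by rewrite ltr_wpDr.
have e'0 : 0 < e' by rewrite divr_gt0.
have : \forall w \near z, D w /\ `|'D_(unitv k) h z - 'D_(unitv k) h w| < e'.
  near=> w; split; first by near: w; exact: open_nbhs_nbhs.
  near: w; move: e' e'0; apply/cvgrPdist_lt.
  exact: (ck_cont _ _ _ _ (ck_partial _ _ _ k hD) Dz).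
move=> /nbhs_ballP[r /= r0 rD].
pose K := `|c| * `|unitv k : 'rV[R]_m| + `|l| + 1.
have K0 : 0 < K by rewrite ltr_wpDl// addr_ge0// mulr_ge0.
near=> t.
have t0 : t != 0 by near: t; exact: nbhs_dnbhs_neq.
have tK : `|t| * K < r.
  rewrite -ltr_pdivlMr//; near: t; apply: dnbhs0_lt.
  by rewrite divr_gt0.
have inb (s : R) : 0 <= s <= 1 -> ball z r ((s * (t * c)) *: unitv k + (t *: l + z)).
  move=> /andP[s0 s1]; rewrite -ball_normE /= addrA opprD addrCA subrr addr0 normrN.
  apply: le_lt_trans tK; apply: le_trans (ler_normD _ _) _.
  rewrite !normrZ (ger0_norm s0) /K !mulrDr mulr1 -addrA lerD//.
    by rewrite [leRHS]mulrA -[leLHS]mulrA ler_piMl// !mulr_ge0.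
  by rewrite lerDl.
have [|s s01 ->] := mvt_unitv h (t *: l + z) k (t * c).
  move=> s s01; apply: (ck_derivable _ _ _ _ _ hD).
  by have [] := rD _ (inb s s01).
have [_ /ltW] := rD _ (inb s s01).
rewrite [t^-1 *: _]mulrA [t^-1 * (t * c)]mulrA mulVf// mul1r -mulrBr normrM => H.
apply: le_trans (_ : `|c| * e' <= e); first exact: ler_wpM2l.
rewrite /e' mulrA ler_pdivrMr// mulrC ler_pM2l// lerDr//.
Unshelve. all: by end_near. Qed.

(** A function with continuous partial derivatives has all its directional
    derivatives, and they are linear in the direction: a direction is built up
    one coordinate at a time, and moving along one coordinate is controlled by
    the mean value theorem and the continuity of that partial derivative. *)
Lemma is_derive_dir D h (z v : 'rV[R]_m) : open D -> ck 1 D h -> D z ->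
  is_derive z v h (\sum_i v 0 i * 'D_(unitv i) h z).
Proof.
move=> oD hD Dz.
have vE : v = \sum_i v 0 i *: unitv i by exact: row_sum_delta.
rewrite {1}vE; elim: (index_enum _) => [|i s IH].
  by rewrite !big_nil; exact: is_derive0.
by rewrite !big_cons; exact: (is_derive_add_unitv D _ _ _ _ _ _ oD hD Dz IH).
Qed.

Section AtMax.
Variables (D : set 'rV[R]_m) (h : 'rV[R]_m -> R) (z : 'rV[R]_m).
Hypotheses (oD : open D) (hD : ck 2 D h) (Dz : D z).
Hypothesis hz : \forall w \near z, h w <= h z.

Let near_line (P : set 'rV[R]_m) (v : 'rV[R]_m) : (\forall w \near z, P w) ->
  exists2 r : R, 0 < r & forall t : R, `|t| < r -> P (t *: v + z).
Proof.
move=> /nbhs_ballP[r /= r0 rP].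
have K0 : 0 < `|v| + 1 by rewrite ltr_wpDl.
exists (r / (`|v| + 1)); first by rewrite divr_gt0.
move=> t; rewrite ltr_pdivlMr// => tr; apply: rP; rewrite -ball_normE /=.
rewrite opprD addrCA subrr addr0 normrN normrZ; apply: le_lt_trans tr.
by rewrite ler_wpM2l// lerDl.
Qed.

Lemma max_dir_derive0 (v : 'rV[R]_m) : \sum_i v 0 i * 'D_(unitv i) h z = 0.
Proof.
have [r r0 rP] : exists2 r : R, 0 < r & forall t : R, `|t| < r ->
    D (t *: v + z) /\ h (t *: v + z) <= h z.
  apply: (near_line (fun w => D w /\ h w <= h z)); near=> w; split; last by near: w.
  by near: w; exact: open_nbhs_nbhs.
have dl (t : R) : `|t| < r -> is_derive t 1 (fun t : R => h (t *: v + z))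
    (\sum_i v 0 i * 'D_(unitv i) h (t *: v + z)).
  move=> /rP[Dt _]; apply/is_derive_line; exact: is_derive_dir (ckW _ _ _ hD) Dt.
have rlt (t : R) : t \in `](- r), r[ -> `|t| < r by rewrite in_itv /= ltr_norml.
pose phi (t : R) := h (t *: v + z).
have phi0 : phi 0 = h z by rewrite /phi scale0r add0r.
have d0 : is_derive (0 : R) 1 phi 0.
  apply: (@derive1_at_max _ phi (- r) r).
  - by rewrite lerNl (le_trans _ (ltW r0))// oppr_le0 ltW.
  - by move=> t /rlt /dl [].
  - by rewrite in_itv /= oppr_lt0 r0.
  - by move=> t /rlt /rP[_]; rewrite phi0.
have d1 := dl 0; rewrite normr0 scale0r add0r in d1; have [_ <-] := d1 r0.
by have [_ ->] := d0.
Unshelve. all: by end_near. Qed.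

Lemma max_partial0 (i : 'I_m) : 'D_(unitv i) h z = 0.
Proof.
rewrite -[RHS](max_dir_derive0 (unitv i)) (bigD1 i)//= big1 ?addr0.
  by rewrite /unitv mxE !eqxx mul1r.
by move=> j ji; rewrite /unitv mxE eqxx /= (negbTE ji) mul0r.
Qed.

(** If the second derivative along [v] were positive, the first derivative
    would be positive shortly after [z], and the function would increase. *)
Lemma max_hessian_le0 (v : 'rV[R]_m) :
  \sum_i \sum_j v 0 i * v 0 j * 'D_(unitv i) ('D_(unitv j) h) z <= 0.
Proof.
rewrite leNgt; apply/negP; set S := \sum_i _ => S0.
pose h1 w := \sum_j v 0 j * 'D_(unitv j) h w.
have h1D : ck 1 D h1.
  by apply: ck_sum => // j; apply: ckM => //; [exact: ck_cst|exact: ck_partial].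
have dh1 : is_derive z v h1 S.
  have := is_derive_dir _ _ _ v oD h1D Dz.
  set S' := \sum_i _; suff -> : S' = S by [].
  apply: eq_bigr => i _.
  have dj j : is_derive z (unitv i) (fun w => v 0 j * 'D_(unitv j) h w)
      (0 * 'D_(unitv j) h z + v 0 j * 'D_(unitv i) ('D_(unitv j) h) z).
    apply: is_deriveMf; apply/derivableP.
    exact: ck_derivable (ck_partial _ _ _ j hD) Dz.
  have [_ ->] := is_derive_sumf _ (index_enum _) _ _ _ _ dj.
  by rewrite mulr_sumr; apply: eq_bigr => j _; rewrite mul0r add0r mulrA.
have h1z : h1 z = 0 by exact: max_dir_derive0.
have := cvg_is_derive _ _ _ _ dh1; rewrite h1z => /cvgr_gt/(_ 0 S0).
move=> /nbhs_ballP[r /= r0 rh1].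
have [q q0 qP] : exists2 r : R, 0 < r & forall t : R, `|t| < r ->
    D (t *: v + z) /\ h (t *: v + z) <= h z.
  apply: (near_line (fun w => D w /\ h w <= h z)); near=> w; split; last by near: w.
  by near: w; exact: open_nbhs_nbhs.
pose t1 := Num.min r q / 2.
have t10 : 0 < t1 by rewrite divr_gt0// lt_min r0.
have t1lt : t1 < Num.min r q by rewrite ltr_pdivrMr// ltr_pMr ?lt_min ?r0// ltr1n.
move: t1lt; rewrite lt_min => /andP[t1r t1q].
pose phi (t : R) := h (t *: v + z).
have dphi (t : R) : `|t| <= t1 -> is_derive t 1 phi (h1 (t *: v + z)).
  move=> tt1; apply/is_derive_line; apply: is_derive_dir oD (ckW _ _ _ hD) _.
  by have [] := qP t (le_lt_trans tt1 t1q).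
have [|| c] := @MVT R phi (fun t => h1 (t *: v + z)) 0 t1 t10.
- move=> t; rewrite in_itv /= => /andP[t0 tt1]; apply: dphi.
  by rewrite ger0_norm ltW.
- apply: derivable_within_continuous => t; rewrite in_itv /= => /andP[t0 tt1].
  have tt : `|t| <= t1 by rewrite ger0_norm.
  by have [] := dphi t tt.
rewrite in_itv /= => /andP[c0 ct1]; rewrite subr0 => E.
have : 0 < h1 (c *: v + z).
  have := rh1 c _ _; rewrite /ball /= sub0r normrN gtr0_norm// subr0.
  move=> /(_ (lt_trans ct1 t1r)); rewrite gt_eqF// => /(_ isT).
  by rewrite pmulr_rgt0// invr_gt0.
have [_] : D (t1 *: v + z) /\ phi t1 <= h z by apply: qP; rewrite gtr0_norm.
have phi0 : phi 0 = h z by rewrite /phi scale0r add0r.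
move=> hle hpos; have := mulr_gt0 hpos t10; rewrite -E phi0 subr_gt0.
by rewrite ltNge hle.
Unshelve. all: by end_near. Qed.

End AtMax.
End Maximum.

(** * The strong maximum principle *)

Section Divergence.
Context {R : realType} {m : nat}.
Implicit Types (D : set 'rV[R]_m) (h : 'rV[R]_m -> R) (B : 'rV[R]_m -> 'M[R]_m).

Definition flux B h (i : 'I_m) (z : 'rV[R]_m) : R :=
  \sum_j B z i j * 'D_(unitv j) h z.

Definition divop B h (z : 'rV[R]_m) : R :=
  \sum_i 'D_(unitv i) (flux B h i) z.

Definition grad_at h (z : 'rV[R]_m) : 'rV[R]_m := \row_i 'D_(unitv i) h z.

Lemma qformE (G : 'M[R]_m) (v : 'rV[R]_m) :
  qform G v = \sum_i \sum_j G i j * v 0 j * v 0 i.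
Proof.
rewrite /qform mxE exchange_big; apply: eq_bigr => j _ /=.
rewrite !mxE mulr_suml; apply: eq_bigr => i _.
by rewrite mulrAC mulrC mulrA mulrAC.
Qed.

Section OnOpen.
Variables (D : set 'rV[R]_m) (B : 'rV[R]_m -> 'M[R]_m).
Hypotheses (oD : open D) (BD : forall i j, ck 1 D (fun z => B z i j)).

Lemma flux_ck h i : ck 2 D h -> ck 1 D (flux B h i).
Proof. by move=> hD; apply: ck_sum => // j; apply: ckM => //; exact: ck_partial. Qed.

Lemma divop_ck h : ck 2 D h -> ck 0 D (divop B h).
Proof. by move=> hD; apply: ck_sum => // i; apply: ck_partial; exact: flux_ck. Qed.

Lemma flux_derivable h i z : ck 2 D h -> D z ->
  derivable (flux B h i) z (unitv i).
Proof. by move=> hD; apply: ck_derivable; exact: flux_ck. Qed.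

Lemma divop_expand h z : ck 2 D h -> D z -> divop B h z =
  \sum_i \sum_j ('D_(unitv i) (fun w => B w i j) z * 'D_(unitv j) h z +
                 B z i j * 'D_(unitv i) ('D_(unitv j) h) z).
Proof.
move=> hD Dz; apply: eq_bigr => i _.
have dj j : is_derive z (unitv i) (fun w => B w i j * 'D_(unitv j) h w)
  ('D_(unitv i) (fun w => B w i j) z * 'D_(unitv j) h z +
                 B z i j * 'D_(unitv i) ('D_(unitv j) h) z).
  apply: is_deriveMf; apply/derivableP; first exact: ck_derivable (BD i j) Dz.
  exact: ck_derivable (ck_partial _ _ _ j hD) Dz.
by have [_ ->] := is_derive_sumf _ (index_enum _) _ _ _ _ dj.
Qed.

Lemma near_open (P : 'rV[R]_m -> Prop) z : D z -> (forall w, D w -> P w) ->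
  \forall w \near z, P w.
Proof.
move=> Dz H; have : nbhs z D by exact: open_nbhs_nbhs.
exact: filterS.
Qed.

Lemma divop_eq h k z : (forall w, D w -> h w = k w) -> D z ->
  divop B h z = divop B k z.
Proof.
move=> hk Dz; apply: eq_bigr => i _; apply: near_eq_derive.
apply: near_open => // w Dw; apply: eq_bigr => j _; congr (_ * _).
by apply: near_eq_derive; exact: near_open.
Qed.

Lemma divopD h k (e : R) z : ck 2 D h -> ck 2 D k -> D z ->
  divop B (fun w => h w + e * k w) z = divop B h z + e * divop B k z.
Proof.
move=> hD kD Dz; rewrite /divop mulr_sumr -big_split; apply: eq_bigr => i _ /=.
have /derivableP dh := flux_derivable h i z hD Dz.
have /derivableP dk := flux_derivable k i z kD Dz.
rewrite -[RHS](@derive_val _ _ _ _ _ _ _ (is_deriveD dh (is_deriveZ e dk))).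
apply: near_eq_derive; apply: near_open => // w Dw.
rewrite /flux /= [RHS]/GRing.add /= /flux [_ *: _]mulr_sumr -big_split.
apply: eq_bigr => j _ /=; rewrite mulrCA -mulrDr; congr (_ * _).
have /derivableP d1 := ck_derivable _ _ _ _ j hD Dw.
have /derivableP d2 := ck_derivable _ _ _ _ j kD Dw.
by have [_ ->] := is_deriveD d1 (is_deriveZ e d2).
Qed.

(** At an interior maximum the first order terms vanish and the second order
    ones are a contraction of [B] with a negative Hessian. *)
Lemma divop_max_le0 h z : posdef (B z) -> ck 2 D h -> D z ->
  (\forall w \near z, h w <= h z) -> divop B h z <= 0.
Proof.
move=> Bz hD Dz hz; rewrite divop_expand//.
rewrite (_ : \sum_i _ = \sum_i \sum_j B z i j *
    (\matrix_(i, j) 'D_(unitv i) ('D_(unitv j) h) z) i j); last first.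
  apply: eq_bigr => i _; apply: eq_bigr => j _.
  by rewrite (max_partial0 D h z oD hD Dz hz) mulr0 add0r mxE.
apply: posdef_contract_le0 => // v.
have := max_hessian_le0 D h z oD hD Dz hz v; congr (is_true (_ <= _)).
by apply: eq_bigr => i _; apply: eq_bigr => j _; rewrite mxE.
Qed.

(** With [k] large the function k psi^2 - psi is a strict subsolution near a
    zero of [psi] where the gradient does not vanish: the square contributes
    2 k B(grad psi, grad psi). *)
Lemma barrier psi q : posdef (B q) -> ck 2 D psi -> D q -> psi q = 0 ->
  grad_at psi q != 0 ->
  exists2 k : R, 0 < k & 0 < divop B (fun w => k * psi w ^+ 2 - psi w) q.
Proof.
move=> [Bsym Bpos] pD Dq pq0 gq0.
have Q0 : 0 < qform (B q) (grad_at psi q) by exact: Bpos.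
set Q := qform _ _ in Q0.
have fluxE k w i : D w -> flux B (fun w => k * psi w ^+ 2 - psi w) i w =
    (2 * k * psi w - 1) * flux B psi i w.
  move=> Dw; rewrite /flux mulr_sumr; apply: eq_bigr => j _.
  rewrite mulrCA; congr (_ * _).
  have /derivableP d1 := ck_derivable _ _ _ _ j pD Dw.
  have := is_deriveB (is_deriveZ k (is_deriveX 2 d1)) d1.
  rewrite [X in is_derive _ _ X _](_ : _ = fun w => k * psi w ^+ 2 - psi w); last first.
    by apply/funext => x; rewrite fctE.
  move=> [_ ->]; rewrite expr1 -[k *: _]/(k * (2 * psi w * 'D_(unitv j) psi w)).
  by ring.
have E k : divop B (fun w => k * psi w ^+ 2 - psi w) q = 2 * k * Q - divop B psi q.
  rewrite /divop /Q qformE mulr_sumr -sumrB; apply: eq_bigr => i _.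
  have Di : is_derive q (unitv i) (fun w => (2 * k * psi w - 1) * flux B psi i w)
      ((2 * k * 'D_(unitv i) psi q) * flux B psi i q +
       (2 * k * psi q - 1) * 'D_(unitv i) (flux B psi i) q).
    apply: is_deriveMf; last by apply/derivableP; exact: flux_derivable.
    have /derivableP d1 := ck_derivable _ _ _ _ i pD Dq.
    have := is_deriveB (is_deriveZ (2 * k) d1) (is_derive_cst (1 : R) q (unitv i)).
    by rewrite subr0.
  transitivity ('D_(unitv i) (fun w => (2 * k * psi w - 1) * flux B psi i w) q).
    by apply: near_eq_derive; apply: near_open => // w Dw; exact: fluxE.
  have [_ ->] := Di; rewrite pq0 mulr0 sub0r mulN1r; congr (_ - _).
  rewrite -mulrA; congr (_ * _); rewrite /flux mulr_sumr; apply: eq_bigr => j _.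
  by rewrite !mxE mulrC.
exists ((1 + `|divop B psi q|) / Q); first by rewrite divr_gt0// ltr_pwDl.
rewrite E -mulrA mulrVK ?unitfE ?gt_eqF//.
have := ler_norm (divop B psi q); have := normr_ge0 (divop B psi q); lra.
Qed.

End OnOpen.
End Divergence.

Section EuclideanGeometry.
Context {R : realType} {m : nat}.
Implicit Types (x z w q : 'rV[R]_m).

Lemma coord_le_norm z (i : 'I_m) : `|z 0 i| <= `|z|.
Proof. by rewrite [leRHS]/Num.norm /= mx_normrE; apply/bigmax_geP; right => /=; exists (0, i). Qed.

Lemma norm_le_coord z (r : R) : 0 <= r -> (forall i, `|z 0 i| <= r) -> `|z| <= r.
Proof.
move=> r0 H; rewrite [leLHS]/Num.norm /= mx_normrE; apply/bigmax_leP; split=> //= -[i j] _ /=.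
by rewrite [i]ord1.
Qed.

(** The Euclidean distance, squared: unlike the norm of the space of row
    vectors, which is the maximum norm, it is smooth. *)
Definition sqdist x z : R := \sum_i (z 0 i - x 0 i) ^+ 2.

Lemma norm_le_sqdist x z : `|z - x| ^+ 2 <= sqdist x z.
Proof.
have s0 : 0 <= sqdist x z by apply: sumr_ge0 => i _; exact: sqr_ge0.
rewrite -[leRHS]sqr_sqrtr// ler_sqr ?nnegrE ?sqrtr_ge0//.
apply: norm_le_coord; first exact: sqrtr_ge0.
move=> i; rewrite -sqrtr_sqr ler_wsqrtr// !mxE /sqdist (bigD1 i)//= lerDl.
by apply: sumr_ge0 => j _; exact: sqr_ge0.
Qed.

Lemma sqdist_le_norm x z : sqdist x z <= m%:R * `|z - x| ^+ 2.
Proof.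
rewrite /sqdist; apply: (@le_trans _ _ (\sum_(i < m) `|z - x| ^+ 2)).
  apply: ler_sum => i _; rewrite -[leLHS]real_normK ?num_real//.
  rewrite ler_sqr ?nnegrE//.
  by have := coord_le_norm (z - x) i; rewrite !mxE.
by rewrite sumr_const card_ord mulr_natl.
Qed.

Lemma sqdist_gt0 x z : z != x -> 0 < sqdist x z.
Proof.
move=> zx; apply: lt_le_trans (norm_le_sqdist x z).
by rewrite exprn_gt0// normr_gt0 subr_eq0.
Qed.

Lemma sqdist_ck r (D : set 'rV[R]_m) x : open D -> ck r D (sqdist x).
Proof.
move=> oD; apply: ck_sum => // i.
have c1 : ck r D (fun z => z 0 i - x 0 i).
  by apply: ckB => //; [exact: ck_coord|exact: ck_cst].
apply: ck_eq oD _ (ckM _ _ _ _ oD c1 c1) => z _; exact: expr2.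
Qed.

Lemma sqdist_cont x z : {for z, continuous (sqdist x)}.
Proof. exact: (ck_cont 0 setT _ _ (sqdist_ck _ _ _ openT)). Qed.

Lemma sqdist_partial x z i : 'D_(unitv i) (sqdist x) z = 2 * (z 0 i - x 0 i).
Proof.
have dj j : is_derive z (unitv i) (fun w : 'rV[R]_m => (w 0 j - x 0 j) ^+ 2)
   (2 * (z 0 j - x 0 j) * (unitv i : 'rV[R]_m) 0 j).
  have := is_deriveB (is_derive_coord z (unitv i) j) (is_derive_cst (x 0 j) z (unitv i)).
  rewrite subr0 => d1; have := is_deriveX 2 d1.
  by rewrite expr1; congr is_derive; apply/funext => w; rewrite fctE.
have [_ ->] := is_derive_sumf _ (index_enum _) _ _ _ _ dj.
rewrite (bigD1 i)//= big1 ?addr0; first by rewrite /unitv mxE !eqxx mulr1.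
by move=> j ji; rewrite /unitv mxE eqxx /= (negbTE ji) mulr0.
Qed.

Definition cball z (r : R) : set 'rV[R]_m := [set w | `|w - z| <= r].

Lemma norm_sub_cont z w : {for w, continuous (fun w => `|w - z| : R)}.
Proof.
apply: (@continuous_comp _ _ _ (fun w => w - z) (fun w => `|w| : R)).
  by apply: continuousB; [exact: cvg_id|exact: cst_continuous].
exact: norm_continuous.
Qed.

Lemma closed_level (C D : set 'rV[R]_m) (h : 'rV[R]_m -> R) (F : set R) :
  closed C -> closed F -> C `<=` D -> (forall z, D z -> {for z, continuous h}) ->
  closed (C `&` h @^-1` F).
Proof.
move=> cC cF CD hc z zcl.
have Cz : C z.
  by apply: cC => N /zcl[w [[Cw _] Nw]]; exists w.
split=> //; apply: cF => N Nh.
have /zcl[w [[_ Fw] Nw]] : nbhs z (h @^-1` N) by exact: hc (CD _ Cz) N Nh.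
by exists (h w).
Qed.

Lemma cball_closed z r : closed (cball z r).
Proof.
have cr : closed [set t : R | t <= r] by exact: closed_le.
have := closed_level setT setT (fun w => `|w - z|) _ closedT cr (fun _ _ => I)
  (fun w _ => norm_sub_cont z w).
by rewrite setTI.
Qed.

Lemma cball_compact z r (A : set 'rV[R]_m) : A `<=` cball z r -> closed A -> compact A.
Proof.
move=> Ab; apply: bounded_closed_compact.
exists (`|z| + r); split; first exact: num_real.
move=> M Mr w /Ab wz; apply: le_trans (ltW Mr).
rewrite -[w](subrK z); apply: le_trans (ler_normD _ _) _.
by rewrite addrC lerD2l.
Qed.

End EuclideanGeometry.

Section StrongMaximum.
Context {R : realType} {m : nat}.
Variables (D : set 'rV[R]_m.+1) (B : 'rV[R]_m.+1 -> 'M[R]_m.+1).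
Hypotheses (oD : open D) (BD : forall i j, ck 1 D (fun z => B z i j)).
Hypothesis Bpos : forall z, D z -> posdef (B z).
Variables (h : 'rV[R]_m.+1 -> R) (mu : R).
Hypotheses (hD : ck 2 D h) (h0 : forall z, D z -> divop B h z = 0).
Hypothesis hmu : forall z, D z -> h z <= mu.

(** Hopf's argument: a maximum of [h] + small multiple of the barrier over a
    small ball around [q] cannot be attained on the boundary of that ball, where
    either [psi] > 0 and the barrier is negative, or [h] < mu; and an interior
    maximum contradicts the strict inequality satisfied by the barrier. *)
Lemma touching_false psi q : D q -> h q = mu -> ck 2 D psi -> psi q = 0 ->
  grad_at psi q != 0 ->
  (forall w, D w -> w != q -> psi w <= 0 -> h w < mu) -> False.
Proof.
move=> Dq hq pD pq0 gq0 psi_h.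
have [k k0 Lk] := barrier D B oD BD psi q (Bpos _ Dq) pD Dq pq0 gq0.
pose bar w := k * psi w ^+ 2 - psi w.
have p2D : ck 2 D (fun w => psi w ^+ 2).
  by apply: ck_eq oD _ (ckM _ _ _ _ oD pD pD) => z _; rewrite expr2.
have barD : ck 2 D bar.
  exact (ckB _ _ _ _ oD (ckM _ _ _ _ oD (ck_cst 2 D k) p2D) pD).
have barq : bar q = 0 by rewrite /bar pq0 expr0n mulr0 subr0.
have : \forall w \near q, [/\ D w, 0 < divop B bar w, k * psi w < 1 & bar w < 1].
  have nD : \forall w \near q, D w by apply: (near_open D oD).
  have nL : \forall w \near q, 0 < divop B bar w.
    have : {for q, continuous (divop B bar)} := ck_cont _ _ _ _ (divop_ck _ _ oD BD _ barD) Dq.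
    by move=> /cvgr_gt; exact.
  have np : \forall w \near q, k * psi w < 1.
    have := ck_cont _ _ _ _ (ckM _ _ _ _ oD (ck_cst 2 D k) pD) Dq.
    by move=> /cvgr_lt; apply; rewrite pq0 mulr0.
  have nb : \forall w \near q, bar w < 1.
    by have := ck_cont _ _ _ _ barD Dq; move=> /cvgr_lt; apply; rewrite barq.
  by near=> w; split; near: w.
move=> /nbhs_ballP[r /= r0 rP].
pose r2 := r / 2.
have r20 : 0 < r2 by rewrite divr_gt0.
have r2r : r2 < r by rewrite ltr_pdivrMr// ltr_pMr// ltr1n.
pose V := cball q r2.
have VP w : V w -> [/\ D w, 0 < divop B bar w, k * psi w < 1 & bar w < 1].
  by move=> Vw; apply: rP; rewrite -ball_normE /= distrC (le_lt_trans Vw).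
have VD : V `<=` D by move=> w /VP[].
have cV : closed V := cball_closed _ _.
pose S := V `&` (fun w => `|w - q|) @^-1` [set r2].
have cS : closed S.
  apply: closed_level cV _ VD (fun w _ => norm_sub_cont q w).
  exact: closed_eq.
pose S0 := S `&` psi @^-1` [set t | t <= 0].
have cS0 : closed S0.
  have c0 : closed [set t : R | t <= 0] by exact: closed_le.
  apply: (closed_level S D _ _ cS c0) => [w [/VD]//|z].
  exact: ck_cont pD.
have S0V : S0 `<=` V by move=> w [[]].
have within A : A `<=` V -> {within A, continuous h}.
  move=> AV; apply: continuous_in_subspaceT => w /set_mem/AV/VD.
  exact: ck_cont hD.
have [eta eta0 etaP] : exists2 eta, 0 < eta & forall w, S0 w -> h w <= mu - eta.
  have [[w0 Sw0]|S00] := pselect (S0 !=set0); last first.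
    by exists 1 => // w Sw; case: S00; exists w.
  have [|||s /set_mem Ss smax] := @EVT_max_rV _ _ h S0.
  - by exists w0.
  - exact: cball_compact S0V cS0.
  - exact: within.
  exists (mu - h s).
    rewrite subr_gt0; apply: psi_h; first exact/VD/S0V.
      case: Ss => -[_ /= sq] _; apply: contra_eq_neq sq => ->.
      by rewrite subrr normr0 lt_eqF.
    by case: Ss.
  by move=> w Sw; rewrite subKr; apply: smax; exact/mem_set.
pose e := eta / 2.
have e0 : 0 < e by rewrite divr_gt0.
pose Phi w := h w + e * bar w.
have PhiD : ck 2 D Phi.
  exact (ckD _ _ _ _ oD hD (ckM _ _ _ _ oD (ck_cst 2 D e) barD)).
have Phiq : Phi q = mu by rewrite /Phi barq mulr0 addr0.
have PhiS w : S w -> Phi w < mu.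
  move=> Sw; have [Dw _ kp b1] := VP _ Sw.1.
  have [p0|p0] := leP (psi w) 0.
    have hw : h w <= mu - eta by apply: etaP.
    have : e * bar w < e by rewrite gtr_pMr.
    rewrite /Phi /e; lra.
  have : bar w < 0.
    rewrite /bar (_ : _ - _ = psi w * (k * psi w - 1)); last by ring.
    by rewrite pmulr_rlt0// subr_lt0.
  rewrite /Phi => b0; have := hmu _ Dw; have : e * bar w < 0 by rewrite pmulr_rlt0.
  lra.
have Vq : V q by rewrite /V /cball /= subrr normr0 ltW.
have [|||z /set_mem Vz zmax] := @EVT_max_rV _ _ Phi V.
- by exists q.
- exact: (cball_compact q r2 V (fun _ x => x) cV).
- by apply: continuous_in_subspaceT => w /set_mem/VD; exact: ck_cont PhiD.
have Phiz : mu <= Phi z by rewrite -Phiq; apply: zmax; exact/mem_set.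
have zint : `|z - q| < r2.
  rewrite lt_neqAle; apply/andP; split; last exact: Vz.
  apply/negP => /eqP zr; have /PhiS : S z by [].
  by rewrite ltNge Phiz.
have zloc : \forall w \near z, Phi w <= Phi z.
  have : \forall w \near z, `|w - q| < r2.
    by have := norm_sub_cont q z; move=> /cvgr_lt; apply.
  by apply: filterS => w wq; apply: zmax; apply/mem_set; rewrite /V /cball /= ltW.
have [Dz Lz _ _] := VP _ Vz.
have := divop_max_le0 D B oD BD Phi z (Bpos _ Dz) PhiD Dz zloc.
rewrite (divopD D)// h0// add0r pmulr_rle0// leNgt => /negP; exact.
Unshelve. all: by end_near. Qed.

(** The set where the maximum is attained is open. Otherwise let [x0] be a point
    near [z0] outside it and [q] a closest point to [x0] in it. The function
    |w - x0|^2 - |q - x0|^2 + |w - q|^2 is positive at all other points of the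
    set, and its gradient at [q] is 2 (q - x0). *)
Lemma strong_maximum z0 : D z0 -> h z0 = mu -> \forall z \near z0, h z = mu.
Proof.
move=> Dz0 hz0; apply: contrapT => not_near.
have /nbhs_ballP[r /= r0 rD] : nbhs z0 D by exact: open_nbhs_nbhs.
pose R0 := r / 2.
have R00 : 0 < R0 by rewrite divr_gt0.
pose V := cball z0 R0.
have VD : V `<=` D.
  move=> w Vw; apply: rD; rewrite -ball_normE /= distrC (le_lt_trans Vw)//.
  by rewrite ltr_pdivrMr// ltr_pMr// ltr1n.
pose delta := R0 / m.+2%:R.
have delta0 : 0 < delta by rewrite divr_gt0.
have [x0 [x0z hx0]] : exists x0, `|x0 - z0| < delta /\ h x0 != mu.
  apply: contrapT => H; apply: not_near; apply/nbhs_ballP.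
  exists delta => //= w; rewrite -ball_normE /= distrC => wz.
  by apply: contrapT => /eqP hw; apply: H; exists w.
pose K := V `&` h @^-1` [set mu].
have cK : closed K.
  have c0 : closed [set t : R | t = mu] by exact: closed_eq.
  apply: (closed_level V D _ _ (cball_closed _ _) c0) => // z.
  exact: ck_cont hD.
have [|||q /set_mem[Vq hq] qmin] := @EVT_min_rV _ _ (sqdist x0) K.
- by exists z0; split=> //; rewrite /V /cball /= subrr normr0 ltW.
- by apply: (cball_compact z0 R0) => // w [].
- by apply: continuous_in_subspaceT => w _; exact: sqdist_cont.
have dz0 : sqdist x0 q <= (m.+1%:R * delta) ^+ 2.
  apply: (@le_trans _ _ (sqdist x0 z0)).
    by apply: qmin; apply/mem_set; split=> //; rewrite /V /cball /= subrr normr0 ltW.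
  apply: le_trans (sqdist_le_norm _ _) _.
  rewrite exprMn; apply: ler_pM => //.
    by rewrite expr2 ler_peMr// ler1n.
  by rewrite ler_sqr ?nnegrE// ?ltW// distrC.
have close w : sqdist x0 w <= sqdist x0 q -> V w.
  move=> wq; have w2 : `|w - x0| ^+ 2 <= (m.+1%:R * delta) ^+ 2.
    by apply: le_trans (norm_le_sqdist _ _) (le_trans wq _).
  have w1 : `|w - x0| <= m.+1%:R * delta.
    by rewrite -ler_sqr ?nnegrE// mulr_ge0// ltW.
  rewrite /V /cball /= -[w - z0](subrKA x0).
  apply: le_trans (ler_normD _ _) _; apply: le_trans (lerD w1 (ltW x0z)) _.
  by rewrite -[X in _ + X]mul1r -mulrDl -natr1 addrC natr1 nat1r /delta mulrC divfK.
have qx0 : q != x0 by apply: contra_neq hx0 => <-.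
pose psi w := sqdist x0 w - sqdist x0 q + sqdist q w.
apply: (touching_false psi q (VD _ Vq) hq).
- exact (ckD _ _ _ _ oD (ckB _ _ _ _ oD (sqdist_ck 2 D x0 oD)
    (ck_cst 2 D (sqdist x0 q))) (sqdist_ck 2 D q oD)).
- rewrite /psi subrr add0r /sqdist big1// => i _.
  by rewrite subrr expr0n.
- have Dpsi i : 'D_(unitv i) psi q = 2 * (q 0 i - x0 0 i).
    have dd x := derivableP (ck_derivable _ _ _ q i (sqdist_ck 1 setT x openT) I).
    have := is_deriveD (is_deriveB (dd x0) (is_derive_cst (sqdist x0 q) q (unitv i))) (dd q).
    by rewrite !sqdist_partial subr0 subrr mulr0 addr0 => -[].
  apply: contra_neq qx0 => /matrixP gr; apply/matrixP => a i.
  have := gr 0 i; rewrite [a]ord1 !mxE Dpsi => /eqP.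
  by rewrite mulf_eq0 pnatr_eq0 /= subr_eq0 => /eqP.
- move=> w Dw wq psiw.
  have lt_wq : sqdist x0 w < sqdist x0 q.
    by have := sqdist_gt0 _ _ wq; move: psiw; rewrite /psi; lra.
  rewrite lt_neqAle hmu// andbT; apply/negP => /eqP hw.
  have : K w by split=> //; apply: close; exact: ltW.
  by move=> /mem_set/qmin; rewrite leNgt lt_wq.
Qed.

End StrongMaximum.

(** * Charts *)

Section Charts.
Context {R : realType} {T : topologicalType} {n : nat}.
Implicit Types (e : chart R T n.+1) (M S : set T) (h : T -> R).

Section OneChart.
Variables (M : set T) (e : chart R T n.+1).
Hypothesis eM : is_chart M e.

Let D := cimg e (~` M).

Lemma chart_cont p : cdom e p -> {for p, continuous (cphi e)}.
Proof.
have [[oe _] _ ce _ _] := eM => ep.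
by move: ce; rewrite continuous_open_subspace// => ce; apply: ce; exact/mem_set.
Qed.

Lemma interior_image_open : open D.
Proof.
have [[_ [Q oQ eQ]] _ _ _ eMP] := eM.
rewrite (_ : D = Q `&` [set z | 0 < z 0 ord0]).
  apply: openI => //; rewrite openE => z /= z0.
  exact: (cvgr_gt _ (@coord_continuous _ _ _ 0 ord0 z)).
apply/seteqP; split => [z [p [ep Mp] <-]|z [Qz z0]].
  have : (Q `&` half_space) (cphi e p) by rewrite -eQ; exists p.
  move=> [Qp hp]; split=> //=; rewrite lt_neqAle; apply/andP; split; last exact: hp.
  by apply/eqP => pz; apply: Mp; apply/(eMP _ ep).
have : (Q `&` half_space) z by split=> //; exact: ltW.
rewrite -eQ => -[p ep pz]; exists p => //; split=> // Mp.
by move/(eMP _ ep): Mp z0; rewrite pz /= => ->; rewrite ltxx.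
Qed.

Lemma cphiK p : cdom e p -> cpsi e (cphi e p) = p.
Proof. by have [_ + _ _ _] := eM; exact. Qed.

Lemma imageP z : D z -> [/\ cdom e (cpsi e z), ~ M (cpsi e z) & cphi e (cpsi e z) = z].
Proof. by move=> [p [ep Mp] <-]; rewrite cphiK. Qed.

Lemma image_in p : cdom e p -> ~ M p -> D (cphi e p).
Proof. by move=> ep Mp; exists p. Qed.

Lemma chart_near (P : T -> Prop) p : cdom e p -> ~ M p ->
  (\forall z \near cphi e p, P (cpsi e z)) -> \forall q \near p, P q.
Proof.
move=> ep Mp HP.
have /chart_cont/(_ _ HP) H := ep.
have [[oe _] _ _ _ _] := eM.
have oep : nbhs p (cdom e) by exact: open_nbhs_nbhs.
by apply: filterS2 oep H => q eq; rewrite /= cphiK.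
Qed.

Lemma interior_near p : cdom e p -> ~ M p -> \forall q \near p, ~ M q.
Proof.
move=> ep Mp; apply: chart_near => //.
have : nbhs (cphi e p) D.
  by apply: open_nbhs_nbhs; split; [exact: interior_image_open|exact: image_in].
by apply: filterS => z /imageP[].
Qed.

Lemma chart_continuous h p : cdom e p -> {for cphi e p, continuous (h \o cpsi e)} ->
  {for p, continuous h}.
Proof.
move=> ep hc N; rewrite -{1}(cphiK _ ep) => /hc HN.
have /chart_cont/(_ _ HN) H := ep.
have [[oe _] _ _ _ _] := eM.
have oep : nbhs p (cdom e) by exact: open_nbhs_nbhs.
by apply: filterS2 oep H => q eq; rewrite /= cphiK.
Qed.

Lemma pd_image h z i : D z -> pd e i h (cpsi e z) = 'D_(unitv i) (h \o cpsi e) z.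
Proof. by move=> /imageP[_ _]; rewrite /pd => ->. Qed.

End OneChart.

(** By the strong maximum principle the set where a positive maximum is attained
    is open; it is closed and does not meet the nonempty boundary, which
    contradicts the connectedness of the manifold. *)
Lemma maximum_principle (A : set (chart R T n.+1)) M (w : T -> R) :
  compact_manifold A M -> M !=set0 -> continuous w ->
  (forall p, M p -> w p = 0) ->
  (forall e, A e -> exists B : 'rV[R]_n.+1 -> 'M[R]_n.+1,
     let D := cimg e (~` M) in
     [/\ forall i j, ck 1 D (fun z => B z i j),
         forall z, D z -> posdef (B z),
         ck 2 D (w \o cpsi e) &
         forall z, D z -> divop B (w \o cpsi e) z = 0]) ->
  forall p, w p <= 0.
Proof.
move=> [[cT _ connT] covA chA _ _] [b Mb] wc w0 wB p; rewrite leNgt; apply/negP => wp.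
have [||c _ cmax] := @compact_EVT_max T R w setT _ cT.
- by exists p.
- exact: continuous_subspaceT.
have {}cmax q : w q <= w c by apply: cmax; exact/mem_set.
have wc0 : 0 < w c by exact: lt_le_trans wp (cmax p).
pose K := [set q | w q = w c].
have KT : K = setT.
  apply: connT; first by exists c.
  - exists K; last by rewrite setTI.
    rewrite openE => q Kq; have [e Ae eq] := covA q.
    have Mq : ~ M q by move=> /w0 wq; move: wc0; rewrite -Kq wq ltxx.
    have eM := chA e Ae; have [B [B1 Bp w2 divw]] := wB e Ae.
    apply: (chart_near _ _ eM) => //.
    apply: (strong_maximum _ _ (interior_image_open _ _ eM) B1 Bp _ _ w2 divw).
    + by move=> z _; exact: cmax.
    + exact: image_in.
    + by rewrite /= (cphiK _ _ eM).
  - exists K; last by rewrite setTI.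
    rewrite (_ : K = w @^-1` [set w c])//.
    by apply: closed_comp => [q _|]; [exact: wc|exact: closed_eq].
have : K b by rewrite KT.
by rewrite /K /= w0// => H; move: wc0; rewrite -H ltxx.
Qed.

End Charts.

(** * The conformal change of the operator *)

Section Quotient.
Context {R : realType} {m : nat}.
Variables (D : set 'rV[R]_m) (B : 'rV[R]_m -> 'M[R]_m).
Hypotheses (oD : open D) (BD : forall i j, ck 1 D (fun z => B z i j)).
Hypothesis Bsym : forall z, D z -> (B z)^T = B z.

(** v^2 B grad(u / v) = v B grad u - u B grad v, and by the symmetry of B the
    divergence of the right-hand side is v div(B grad u) - u div(B grad v). *)
Lemma divop_quotient (u v : 'rV[R]_m -> R) z : ck 2 D u -> ck 2 D v ->
  (forall w, D w -> v w != 0) -> D z ->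
  divop (fun w => v w ^+ 2 *: B w) (fun w => u w / v w) z =
  v z * divop B u z - u z * divop B v z.
Proof.
move=> uD vD v0 Dz.
have fluxE i w : D w -> flux (fun w => v w ^+ 2 *: B w) (fun w => u w / v w) i w =
    v w * flux B u i w - u w * flux B v i w.
  move=> Dw; rewrite /flux !mulr_sumr -sumrB; apply: eq_bigr => j _.
  have /derivableP du := ck_derivable _ _ _ _ j uD Dw.
  have dv' := ck_derivable _ _ _ _ j vD Dw; have /derivableP dv := dv'.
  have dV : is_derive w (unitv j) (fun x => (v x)^-1)
      (- v w ^- 2 * 'D_(unitv j) v w).
    by split; [apply: derivableV => //; exact: v0|rewrite deriveV ?v0].
  have [_ ->] := is_deriveMf _ _ _ _ _ _ du dV.
  rewrite mxE; have := v0 _ Dw; set x := v w; set y := u w => x0.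
  by field.
have DE i : 'D_(unitv i) (flux (fun w => v w ^+ 2 *: B w) (fun w => u w / v w) i) z =
    ('D_(unitv i) v z * flux B u i z + v z * 'D_(unitv i) (flux B u i) z) -
    ('D_(unitv i) u z * flux B v i z + u z * 'D_(unitv i) (flux B v i) z).
  have du := derivableP (ck_derivable _ _ _ _ i uD Dz).
  have dv := derivableP (ck_derivable _ _ _ _ i vD Dz).
  have dfu := derivableP (flux_derivable _ _ oD BD u i z uD Dz).
  have dfv := derivableP (flux_derivable _ _ oD BD v i z vD Dz).
  have [_ <-] := is_deriveB (is_deriveMf _ _ _ _ _ _ dv dfu) (is_deriveMf _ _ _ _ _ _ du dfv).
  by apply: near_eq_derive; apply: (near_open D oD) => // w Dw; exact: fluxE.
transitivity (\sum_i (('D_(unitv i) v z * flux B u i z + v z * 'D_(unitv i) (flux B u i) z) -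
    ('D_(unitv i) u z * flux B v i z + u z * 'D_(unitv i) (flux B v i) z))).
  by apply: eq_bigr => i _; exact: DE.
have sumE (a b c d : 'I_m -> R) (x y : R) :
    \sum_i ((a i + x * b i) - (c i + y * d i)) =
    (\sum_i a i - \sum_i c i) + (x * \sum_i b i - y * \sum_i d i).
  by rewrite sumrB !big_split /= -!mulr_sumr; ring.
rewrite sumE -[RHS]add0r; congr (_ + _); apply/eqP; rewrite subr_eq0; apply/eqP.
rewrite /flux; under eq_bigr do rewrite mulr_sumr.
under [RHS]eq_bigr do rewrite mulr_sumr.
rewrite exchange_big; apply: eq_bigr => i _; apply: eq_bigr => j _ /=.
have /matrixP/(_ i j) := Bsym _ Dz; rewrite mxE => ->; ring.
Qed.

End Quotient.

Section Metric.
Context {R : realType} {T : topologicalType} {n : nat}.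
Variables (A : set (chart R T n.+1)) (M : set T) (g : @bfield R T n).
Hypotheses (chA : forall e, A e -> is_chart M e) (gM : is_metric A (~` M) g).
Variable e : chart R T n.+1.
Hypothesis Ae : A e.

Let D := cimg e (~` M).
Let G (z : 'rV[R]_n.+1) := g e (cpsi e z).

Let oD : open D.
Proof. exact/interior_image_open/chA. Qed.

Lemma metric_posdef z : D z -> posdef (G z).
Proof.
by have [/(_ e Ae)[_ Gp] _] := gM; move=> /(imageP _ _ (chA _ Ae))[ez Mz _]; exact: Gp.
Qed.

(** The Laplacian of [g] in divergence form is (det G)^(-1/2) div(B grad)
    with this matrix B. *)
Definition density z : 'M[R]_n.+1 := Num.sqrt (\det (G z)) *: invmx (G z).

Lemma sqrt_det_gt0 z : D z -> 0 < Num.sqrt (\det (G z)).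
Proof. by move=> /metric_posdef/posdef_det; rewrite sqrtr_gt0. Qed.

Lemma density_posdef z : D z -> posdef (density z).
Proof.
move=> Dz; apply: posdef_scale; first exact: sqrt_det_gt0.
exact/posdef_inv/metric_posdef.
Qed.

Lemma density_ck i j : ck 2 D (fun z => density z i j).
Proof.
have GD i' j' : ck 2 D (fun z => G z i' j').
  have [/(_ e Ae)[GC _] _] := gM.
  exact: (Cr_on_ck None 2 _ _ oD isT (GC i' j')).
have dD : ck 2 D (fun z => Num.sqrt (\det (G z))).
  apply: (ck_sqrt _ _ _ oD); last exact: ck_det.
  by move=> z /metric_posdef/posdef_det.
have iD : ck 2 D (fun z => invmx (G z) i j).
  by apply: ck_invmx => // z /metric_posdef/posdef_unit.
by apply: ck_eq oD _ (ckM _ _ _ _ oD dD iD) => z _; rewrite mxE.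
Qed.

Lemma Cr_fun_ck ro r h : upto ro r -> Cr_fun ro A (~` M) h -> ck r D (h \o cpsi e).
Proof. by move=> ror hC; exact: Cr_on_ck oD ror (hC e Ae). Qed.

(** Divergences and Laplacians are compared through the operators [divop B],
    which only involve the coordinates of one chart. *)
Lemma divg_divop (g' : @bfield R T n) (V : vector_field) B h z : D z ->
  (forall w i, D w ->
     Num.sqrt (\det (g' e (cpsi e w))) * V e (cpsi e w) 0 i =
     flux B (h \o cpsi e) i w) ->
  divg g' V e (cpsi e z) =
  (Num.sqrt (\det (g' e (cpsi e z))))^-1 * divop B (h \o cpsi e) z.
Proof.
move=> Dz VE; rewrite /divg; congr (_ * _); apply: eq_bigr => i _.
rewrite (pd_image M _ (chA _ Ae))//; apply: near_eq_derive.
by apply: (near_open D oD) => // w Dw; exact: VE.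
Qed.

Lemma laplace_divop h z : D z -> laplace g h e (cpsi e z) =
  (Num.sqrt (\det (G z)))^-1 * divop density (h \o cpsi e) z.
Proof.
move=> Dz; apply: divg_divop => // w i Dw.
rewrite /flux !mxE mulr_sumr; apply: eq_bigr => j _.
by rewrite (pd_image M _ (chA _ Ae))// /density !mxE mulrA.
Qed.

(** With rho = v^(1/(n-s)) the density of [rho^2 g] contributes rho^(n+1), the
    inverse metric rho^(-2) and the weight rho^a; the product is
    rho^(2(n-s)) = v^2. *)
Lemma conformal_divg (gamma a : R) (rho v W : T -> R) z :
  gamma < n%:R / 2 -> a = 1 - 2 * gamma ->
  (forall p, ~ M p -> 0 < v p) ->
  (forall p, ~ M p -> rho p = v p `^ (n%:R - (n%:R / 2 + gamma))^-1) ->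
  D z ->
  let gs := conformal_metric rho g in
  divg gs (fun k q => rho q `^ a *: grad gs W k q) e (cpsi e z) =
  (Num.sqrt (\det (gs e (cpsi e z))))^-1 *
  divop (fun w => v (cpsi e w) ^+ 2 *: density w) (W \o cpsi e) z.
Proof.
move=> gn aE v0 rhoE Dz gs; apply: divg_divop => // w i Dw.
have [ew Mw _] := imageP _ _ (chA _ Ae) _ Dw.
set q := cpsi e w; set x := v q; have x0 : 0 < x by exact: v0.
set b := (n%:R - (n%:R / 2 + gamma))^-1.
have rq : rho q = x `^ b by exact: rhoE.
have r0 : 0 < rho q by rewrite rq powR_gt0.
have r0' := ltW r0; have x0' := ltW x0.
have GU : G w \in unitmx by exact/posdef_unit/metric_posdef.
have sdet : Num.sqrt (\det (gs e q)) = rho q ^+ n.+1 * Num.sqrt (\det (G w)).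
  rewrite /gs /conformal_metric detZ sqrtrM ?exprn_ge0 ?sqr_ge0//.
  by rewrite -exprM mulnC exprM sqrtr_sqr ger0_norm// exprn_ge0// ltW.
have inv : invmx (gs e q) = rho q ^- 2 *: invmx (G w).
  rewrite /gs /conformal_metric invmxZ// unitmxZ//.
  by rewrite unitfE expf_neq0// gt_eqF.
have pw : rho q ^+ n.+1 * (rho q `^ a * rho q ^- 2) = x ^+ 2.
  rewrite -[rho q ^+ n.+1]powR_mulrn// -[rho q ^+ 2]powR_mulrn// -powRN.
  rewrite -!powRD; try by apply/implyP => _; rewrite gt_eqF.
  rewrite rq -powRrM -[RHS]powR_mulrn//; congr (_ `^ _).
  rewrite /b aE -natr1; field.
  by apply/eqP; lra.
rewrite sdet mxE [grad _ _ _ _ _ _]mxE inv /flux !mulr_sumr; apply: eq_bigr => j _.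
rewrite (pd_image M _ (chA _ Ae))// !mxE -/q -/x -pw.
by ring.
Qed.

End Metric.

(** * The collar of the boundary *)

Lemma near_eq_continuous {S S' : topologicalType} (f h : S -> S') (p : S) :
  (\forall q \near p, f q = h q) -> {for p, continuous h} -> {for p, continuous f}.
Proof.
move=> fh hc; have : h @ p --> f p by rewrite (nbhs_singleton fh).
by apply: cvg_trans; apply: near_eq_cvg; apply: filterS fh => q ->.
Qed.

Lemma powR_cvg_nneg {R : realType} {S : Type} (F : set_system S) {FF : Filter F}
    (phi : S -> R) (b : R) : 0 < b ->
  (\forall x \near F, 0 <= phi x) -> phi @ F --> 0 -> phi x `^ b @[x --> F] --> 0.
Proof.
move=> b0 p0 pc; apply/cvgrPdist_lt => e e0.
have eb : 0 < e `^ b^-1 by exact: powR_gt0.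
have : \forall x \near F, `|0 - phi x| < e `^ b^-1 by move/cvgrPdist_lt: pc; exact.
 apply: filterS2 p0 => x px.
rewrite !sub0r !normrN (ger0_norm px) (ger0_norm (powR_ge0 _ _)) => pe.
rewrite -[e]powRr1 ?ltW// -(mulVf (lt0r_neq0 b0)) powRrM.
by apply: gt0_ltr_powR => //; rewrite nnegrE// powR_ge0.
Qed.

Section Collar.
Context {R : realType} {T : topologicalType} {n : nat}.
Variables (A : set (chart R T n.+1)) (M : set T) (g : @bfield R T n).
Variable (gh : @bd_bfield R T n).
Variables (y : T -> R) (delta : R) (c : T -> R -> T).
Hypotheses (hX : compact_manifold A M) (hy : geodesic_defining A M g gh y delta c).

Let chA e : A e -> is_chart M e.
Proof. by have [_ _ H _ _] := hX; exact: H. Qed.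

Lemma ccons0 t (x : 'rV[R]_n) : ccons t x 0 ord0 = t.
Proof.
rewrite /ccons (_ : ord0 = lshift n (0 : 'I_1)); last exact/val_inj.
by rewrite (@row_mxEl R 1 1 n) mxE eqxx.
Qed.

(** Charts in which the collar lines are the lines of the 0-th coordinate. *)
Definition adapted (k : chart R T n.+1) (p : T) (x : 'rV[R]_n) : Prop :=
  [/\ A k, cdom k p,
      forall t, 0 <= t < delta -> cdom k (c p t) /\ cphi k (c p t) = ccons t x &
      forall q, cdom k q -> exists p' t,
        [/\ M p', 0 <= t < delta, q = c p' t, y q = t & cphi k q 0 ord0 = t]].

Lemma adapted_ex p : M p -> exists k x, adapted k p x.
Proof.
move=> Mp; have [d0 [c0 cinj yc [gy [_ _ _ H]]]] := hy.
have [_ covA _ _ _] := hX; have [e Ae ep] := covA p.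
have [k Ak [kE kc _]] := H e Ae.
exists k, (ctail (cphi e p)); split=> //.
- by rewrite kE; exists p, 0; rewrite lexx d0 c0.
- by move=> t tI; split; [rewrite kE; exists p, t|exact: kc].
- move=> q; rewrite kE => -[p' [t [Mp' ep' tI ->]]]; exists p', t; split=> //.
    exact: yc.
  by rewrite kc// ccons0.
Qed.

Lemma collar_interior p t : M p -> 0 < t < delta -> ~ M (c p t).
Proof.
move=> Mp /andP[t0 td]; have [k [x [Ak _ kc _]]] := adapted_ex p Mp.
have [kpt kE] : cdom k (c p t) /\ cphi k (c p t) = ccons t x by apply: kc; rewrite ltW.
have [_ _ _ _ kM] := chA _ Ak.
by move=> /(kM _ kpt); rewrite kE ccons0 => t00; rewrite t00 ltxx in t0.
Qed.

Lemma collar_y p t : M p -> 0 <= t < delta -> y (c p t) = t.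
Proof. by have [_ [_ _ H _]] := hy; exact: H. Qed.

Lemma collar_base p : M p -> c p 0 = p.
Proof. by have [_ [H _ _ _]] := hy; exact: H. Qed.

Lemma adapted_y k p x q : adapted k p x -> cdom k q -> y q = cphi k q 0 ord0.
Proof. by move=> [_ _ _ H] /H [p' [t [_ _ _ -> ->]]]. Qed.

Lemma adapted_near k p x : adapted k p x -> \forall q \near p, cdom k q.
Proof.
move=> [Ak kp _ _]; have [[ok _] _ _ _ _] := chA _ Ak.
exact: open_nbhs_nbhs.
Qed.

Lemma y_cont p : M p -> {for p, continuous y}.
Proof.
move=> Mp; have [k [x kad]] := adapted_ex p Mp; have [Ak kp _ _] := kad.
have kc := chart_cont _ _ (chA _ Ak) _ kp.
have nE : \forall q \near p, y q = ((fun z : 'rV[R]_n.+1 => z 0 ord0) \o cphi k) q.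
  by apply: filterS (adapted_near _ _ _ kad) => q; exact: adapted_y kad.
apply: near_eq_continuous nE _.
exact: continuous_comp kc (@coord_continuous _ _ _ _ _ _).
Qed.

Lemma y_boundary p : M p -> y p = 0.
Proof.
move=> Mp; have [d0 _] := hy.
by rewrite -{1}(collar_base p Mp) collar_y// lexx d0.
Qed.

Lemma near_collar p eps : M p -> 0 < eps ->
  \forall q \near p, collar M c [set: T] eps q.
Proof.
move=> Mp e0; have [k [x kad]] := adapted_ex p Mp.
have yp : \forall q \near p, y q < eps.
  by have := y_cont p Mp; move=> /cvgr_lt; apply; rewrite y_boundary.
apply: filterS2 (adapted_near _ _ _ kad) yp => q kq.
have [_ _ _ /(_ _ kq)[p' [t [Mp' /andP[t0 _] -> -> _]]]] := kad => te.
by exists p', t; rewrite t0 te.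
Qed.

(** Smoothness up to the boundary is local extendability; in an adapted chart
    the extension is a function of the collar coordinates, which can be
    differentiated along the collar line at the boundary itself. *)
Lemma smooth_extension k p x eps F : M p -> adapted k p x -> 0 < eps <= delta ->
  Cr_fun None A (collar M c [set: T] eps) F ->
  exists V Fh, [/\ open V, V (ccons 0 x), class_Cr None V Fh &
    forall q, cdom k q -> collar M c [set: T] eps q -> V (cphi k q) ->
      F q = Fh (cphi k q)].
Proof.
move=> Mp kad /andP[e0 ed] FC; have [Ak kp kc _] := kad; have [d0 _] := hy.
have pE : cphi k p = ccons 0 x.
  by have [|_] := kc 0; rewrite ?lexx ?d0// collar_base.
have zD : cimg k (collar M c [set: T] eps) (ccons 0 x).
  rewrite -pE; exists p => //; split=> //; exists p, 0.
  by rewrite lexx e0 collar_base.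
have [V [Fh [oV Vz VC VF]]] := FC k Ak _ zD.
exists V, Fh; split=> // q kq cq Vq; rewrite VF//=; last by exists q.
by rewrite (cphiK _ _ (chA _ Ak)).
Qed.

Lemma collar_cont p eps F : M p -> 0 < eps <= delta ->
  Cr_fun None A (collar M c [set: T] eps) F -> {for p, continuous F}.
Proof.
move=> Mp ed FC; have [k [x kad]] := adapted_ex p Mp; have [Ak kp kc _] := kad.
have [V [Fh [oV Vz VC VF]]] := smooth_extension _ _ _ _ _ Mp kad ed FC.
have [d0 _] := hy.
have pE : cphi k p = ccons 0 x.
  by have [|_] := kc 0; rewrite ?lexx ?d0// collar_base.
have kc' := chart_cont _ _ (chA _ Ak) _ kp.
have Fc : {for p, continuous (Fh \o cphi k)}.
  apply: continuous_comp kc' _; rewrite pE.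
  exact: (ck_cont 0 V _ _ (class_Cr_ck None 0 _ _ isT VC)).
have e0 : 0 < eps by case/andP: ed.
have Vn : \forall q \near p, V (cphi k q).
  apply: kc'; apply: open_nbhs_nbhs; split=> //; by rewrite pE.
have nE : \forall q \near p, F q = (Fh \o cphi k) q.
  near=> q; apply: VF; near: q.
  - exact: adapted_near kad.
  - exact: near_collar.
  - exact: Vn.
exact: near_eq_continuous nE Fc.
Unshelve. all: by end_near. Qed.

Section Scattering.
Variable gamma : R.
Hypotheses (gamma_gt0 : 0 < gamma).
Let s := n%:R / 2 + gamma.

(** Factoring out y^(n-s) leaves a function which is continuous up to the
    boundary, so that quotients of scattering solutions are. *)
Lemma scattering_form f u H : scattering_solution A M g y delta c s f u H ->
  exists F eps, [/\ 0 < eps <= delta,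
    Cr_fun None A (collar M c [set: T] eps) F,
    Cr_fun None A (collar M c [set: T] eps) H,
    forall p, M p -> even_expansion n (fun t => F (c p t)) /\ F p = f p &
    forall q, collar M c [set: T] eps q -> ~ M q -> 0 < y q /\
      u q = y q `^ (n%:R - s) * (F q + H q * y q `^ (2 * gamma))].
Proof.
move=> [_ _ [F [eps [ed [FC HC] ev Ff uE]]]]; exists F, eps; split=> //.
  by move=> p Mp; split; [have [] := ev p Mp|exact: Ff].
move=> q cq Mq; have [p [t [Mp _ /andP[t0 te] qE]]] := cq.
have td : 0 <= t < delta by rewrite t0; case/andP: ed => _; exact: lt_le_trans.
have yq : y q = t by rewrite qE collar_y.
have y0 : 0 < y q.
  rewrite yq lt_neqAle t0 andbT; apply/negP => /eqP t00; apply: Mq.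
  by rewrite qE -t00 collar_base.
have yE : y q `^ s = y q `^ (n%:R - s) * y q `^ (2 * gamma).
  rewrite -powRD; last by apply/implyP => _; rewrite gt_eqF.
  by congr (_ `^ _); rewrite /s; field.
by split=> //; rewrite uE// yE; ring.
Qed.

Lemma scattering_ratio_cvg f u H h v K p : M p ->
  scattering_solution A M g y delta c s f u H ->
  scattering_solution A M g y delta c s h v K ->
  h p != 0 ->
  exists2 r : T -> R, r @ p --> f p / h p &
    \forall q \near p, ~ M q -> u q / v q = r q.
Proof.
move=> Mp /scattering_form[F [e1 [e1d FC HC Ff uE]]].
move=> /scattering_form[F' [e2 [e2d FC' KC Ff' vE]]] hp.
pose N (F H : T -> R) q := F q + H q * y q `^ (2 * gamma).
have Ncont G L eps : 0 < eps <= delta ->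
    Cr_fun None A (collar M c [set: T] eps) G ->
    Cr_fun None A (collar M c [set: T] eps) L -> N G L @ p --> G p.
  move=> ed GC LC.
  have yc : y q `^ (2 * gamma) @[q --> p] --> (0 : R).
    apply: powR_cvg_nneg; first by rewrite mulr_gt0.
      apply: filterS (near_collar p eps Mp (andP ed).1) => q [p' [t [Mp' _ /andP[t0 te] ->]]].
      by rewrite collar_y// t0 (lt_le_trans te)//; case/andP: ed.
    have yc : y @ p --> y p by exact: y_cont.
    by rewrite y_boundary in yc.
  rewrite -[G p]addr0 -(mulr0 (L p)).
  apply: cvgD; first exact: collar_cont ed GC.
  by apply: cvgM yc; exact: collar_cont ed LC.
exists (fun q => N F H q / N F' K q).
  apply: cvgM; first by rewrite -(Ff p Mp).2; exact: Ncont e1d FC HC.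
  by apply: cvgV => //; rewrite -(Ff' p Mp).2; exact: Ncont e2d FC' KC.
have c1 := near_collar p e1 Mp (andP e1d).1.
have c2 := near_collar p e2 Mp (andP e2d).1.
apply: filterS2 c1 c2 => q q1 q2 Mq.
have [y0 ->] := uE q q1 Mq; have [_ ->] := vE q q2 Mq.
by rewrite -mulf_div divff ?mul1r// gt_eqF// powR_gt0.
Qed.

End Scattering.
End Collar.

(** * Solutions of the extension problem as quotients of scattering solutions *)

Section Uniqueness.
Context {R : realType} {T : topologicalType} {n : nat}.
Variables (A : set (chart R T n.+1)) (M : set T) (g : @bfield R T n).
Variable (gh : @bd_bfield R T n).
Variables (y : T -> R) (delta : R) (c : T -> R -> T).
Hypotheses (hX : compact_manifold A M) (gM : is_metric A (~` M) g).
Hypothesis hy : geodesic_defining A M g gh y delta c.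
Variable gamma : R.
Hypotheses (gamma_gt0 : 0 < gamma).
Let s := n%:R / 2 + gamma.
Variables v K : T -> R.
Hypothesis hv : scattering_solution A M g y delta c s (fun=> 1) v K.
Hypothesis v_gt0 : forall p, ~ M p -> 0 < v p.

Let chA e : A e -> is_chart M e.
Proof. by have [_ _ H _ _] := hX; exact: H. Qed.

Let Bv e z := v (cpsi e z) ^+ 2 *: density g e z.

Definition weighted_harmonic (W : T -> R) : Prop :=
  forall e z, A e -> cimg e (~` M) z -> divop (Bv e) (W \o cpsi e) z = 0.

Lemma weighted_harmonic_cst (a : R) : weighted_harmonic (fun=> a).
Proof.
move=> e z Ae Dz; apply: big1 => i _.
have -> : flux (Bv e) ((fun=> a) \o cpsi e) i = cst 0; last exact: derive_cst.
apply/funext => w; apply: big1 => j _.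
by rewrite (derive_cst (a : R)) mulr0.
Qed.

Let vC e : A e -> ck 2 (cimg e (~` M)) (v \o cpsi e).
Proof. by move=> Ae; have [vC _ _] := hv; exact: (Cr_fun_ck _ _ chA _ Ae (Some 2%N) 2 _ isT vC). Qed.

Let Bv_ck e i j : A e -> ck 1 (cimg e (~` M)) (fun z => Bv e z i j).
Proof.
move=> Ae; have oD := interior_image_open _ _ (chA _ Ae).
have v1 := ckW _ _ _ (vC e Ae).
have d1 := ckW _ _ _ (density_ck _ _ _ chA gM _ Ae i j).
apply: ck_eq oD _ (ckM _ _ _ _ oD (ckM _ _ _ _ oD v1 v1) d1) => z _.
by rewrite !mxE expr2.
Qed.

Let Bv_posdef e z : A e -> cimg e (~` M) z -> posdef (Bv e z).
Proof.
move=> Ae Dz; have [_ Mz _] := imageP _ _ (chA _ Ae) _ Dz.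
apply: posdef_scale; first by rewrite exprn_gt0// v_gt0.
exact: (density_posdef _ _ _ chA gM _ Ae).
Qed.

Section Ratio.
Variables (f u H : T -> R).
Hypothesis hu : scattering_solution A M g y delta c s f u H.

Let uC e : A e -> ck 2 (cimg e (~` M)) (u \o cpsi e).
Proof. by move=> Ae; have [uC _ _] := hu; exact: (Cr_fun_ck _ _ chA _ Ae (Some 2%N) 2 _ isT uC). Qed.

Let ratioC e : A e -> ck 2 (cimg e (~` M)) (fun z => u (cpsi e z) / v (cpsi e z)).
Proof.
move=> Ae; have oD := interior_image_open _ _ (chA _ Ae).
apply: (ckM _ _ _ _ oD (uC e Ae)); apply: (ckV _ _ _ oD _ (vC e Ae)).
by move=> z /(imageP _ _ (chA _ Ae))[_ Mz _]; rewrite gt_eqF// v_gt0.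
Qed.

Lemma scattering_divop e f' u' H' z : A e ->
  scattering_solution A M g y delta c s f' u' H' -> cimg e (~` M) z ->
  divop (density g e) (u' \o cpsi e) z =
  - (s * (n%:R - s)) * Num.sqrt (\det (g e (cpsi e z))) * u' (cpsi e z).
Proof.
move=> Ae [_ E _] Dz; have [ez Mz _] := imageP _ _ (chA _ Ae) _ Dz.
have := E _ _ Ae ez Mz; rewrite (laplace_divop _ _ _ chA _ Ae)//.
have := sqrt_det_gt0 _ _ _ chA gM _ Ae _ Dz.
set q := Num.sqrt _ => q0 /eqP; rewrite subr_eq0 => /eqP qE.
rewrite -[LHS](mulVKf (lt0r_neq0 q0)) -[q^-1 * _]opprK qE; ring.
Qed.

(** The zero order terms of the two eigenvalue equations cancel in
    [divop_quotient]. *)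
Lemma ratio_harmonic e z : A e -> cimg e (~` M) z ->
  divop (Bv e) (fun w => u (cpsi e w) / v (cpsi e w)) z = 0.
Proof.
move=> Ae Dz; have oD := interior_image_open _ _ (chA _ Ae).
have d1 i j := ckW _ _ _ (density_ck _ _ _ chA gM _ Ae i j).
have dsym w : cimg e (~` M) w -> (density g e w)^T = density g e w.
  by move=> Dw; have [] := density_posdef _ _ _ chA gM _ Ae w Dw.
have v0 w : cimg e (~` M) w -> (v \o cpsi e) w != 0.
  by move=> /(imageP _ _ (chA _ Ae))[_ Mw _]; rewrite /= gt_eqF// v_gt0.
have -> := divop_quotient _ _ oD d1 dsym _ _ _ (uC e Ae) (vC e Ae) v0 Dz.
rewrite (scattering_divop e _ _ _ z Ae hu Dz) (scattering_divop e _ _ _ z Ae hv Dz) /=.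
by ring.
Qed.

(** The difference of W and u / v extends continuously by 0 to the boundary,
    so the maximum principle applies to it and to its opposite. *)
Lemma extension_ratio W : M !=set0 -> Cr_fun (Some 2%N) A (~` M) W ->
  continuous W -> weighted_harmonic W -> (forall p, M p -> W p = f p) ->
  forall p, ~ M p -> W p = u p / v p.
Proof.
move=> M0 WC Wcont Wh Wf.
pose w p := if `[< M p >] then 0 else W p - u p / v p.
have wM p : M p -> w p = 0 by rewrite /w => /asboolP ->.
have wX p : ~ M p -> w p = W p - u p / v p by rewrite /w => /asboolPn/negbTE ->.
have wcont : continuous w.
  move=> p; have [_ covA _ _ _] := hX; have [e Ae ep] := covA p.
  have [Mp|Mp] := pselect (M p).
    have h1 : (1 : R) != 0 by exact: oner_neq0.
    have [r rc rE] := scattering_ratio_cvg _ _ _ _ _ _ _ hX hy _ gamma_gt0 _ _ _ _ _ _ p Mp hu hv h1.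
    rewrite /continuous_at wM//; apply/cvgrPdist_lt => eps eps0.
    have Wr : W q - r q @[q --> p] --> (0 : R).
      rewrite divr1 in rc.
      by rewrite -(subrr (f p)); apply: cvgB rc; rewrite -Wf//; exact: Wcont.
    move/cvgrPdist_lt: Wr => /(_ _ eps0).
    apply: filterS2 rE => q rE; have [Mq|Mq] := pselect (M q).
      by rewrite wM// subrr normr0.
    by rewrite wX// rE.
  have nE : \forall q \near p, w q = W q - u q / v q.
    by apply: filterS (interior_near _ _ (chA _ Ae) _ ep Mp) => q; exact: wX.
  apply: near_eq_continuous nE _.
  have rcont : {for p, continuous (fun q => u q / v q)}.
    apply: (chart_continuous _ _ (chA _ Ae) _ _ ep).
    by apply: ck_cont (ratioC e Ae) _; exists p.
  by apply: continuousB rcont; exact: Wcont.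
have wC e : A e -> ck 2 (cimg e (~` M)) (w \o cpsi e) /\
    forall z, cimg e (~` M) z -> divop (Bv e) (w \o cpsi e) z = 0.
  move=> Ae; have oD := interior_image_open _ _ (chA _ Ae).
  have W2 := Cr_fun_ck _ _ chA _ Ae (Some 2%N) 2 _ isT WC.
  pose d z := (W \o cpsi e) z + -1 * (u (cpsi e z) / v (cpsi e z)).
  have d2 : ck 2 (cimg e (~` M)) d.
    exact (ckD _ _ _ _ oD W2 (ckM _ _ _ _ oD (ck_cst 2 _ (-1)) (ratioC e Ae))).
  have dw z : cimg e (~` M) z -> d z = (w \o cpsi e) z.
    by move=> /(imageP _ _ (chA _ Ae))[_ Mz _]; rewrite /= wX// /d mulN1r.
  split; first exact: ck_eq oD dw d2.
  move=> z Dz; rewrite -(divop_eq _ _ oD d _ _ dw Dz).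
  rewrite (divopD _ _ oD (fun i j => Bv_ck e i j Ae) _ _ _ _ W2 (ratioC e Ae) Dz).
  by rewrite Wh// ratio_harmonic// mulr0 addr0.
have le0 p : w p <= 0.
  apply: (maximum_principle _ _ _ hX M0 wcont wM) => e Ae; exists (Bv e).
  by have [w2 wh] := wC e Ae; split=> // [i j|z]; [exact: Bv_ck|exact: Bv_posdef].
have ge0 p : - w p <= 0.
  have Nc : continuous (fun p => - w p) by move=> q; apply: continuousN; exact: wcont.
  have N0 q : M q -> - w q = 0 by move=> /wM ->; rewrite oppr0.
  apply: (maximum_principle _ _ _ hX M0 Nc N0) => e Ae; exists (Bv e).
  have [w2 wh] := wC e Ae; have oD := interior_image_open _ _ (chA _ Ae).
  split=> [i j|z||z Dz]; [exact: Bv_ck|exact: Bv_posdef|exact: ckN|].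
  have := divopD _ _ oD (fun i j => Bv_ck e i j Ae) (fun=> 0) _ (-1) z (ck_cst 2 _ 0) w2 Dz.
  rewrite wh// mulr0 addr0 (weighted_harmonic_cst 0 e z Ae Dz) => <-.
  by apply: divop_eq oD _ _ _ _ Dz => q _ /=; rewrite add0r mulN1r.
move=> p Mp; have := le0 p; have := ge0 p; rewrite wX//; lra.
Qed.

End Ratio.
End Uniqueness.

(** * Asymptotics along a collar line *)

Section Asymptotics.
Context {R : realType}.
Implicit Types (F H U rho : R -> R) (r t l : R).

Lemma near0P (P : R -> Prop) :
  (\forall t \near 0^'+, P t) <-> exists2 r, 0 < r & forall t, 0 < t < r -> P t.
Proof.
split.
  move=> /nbhs_ballP[r /= r0 rP]; exists r => // t /andP[t0 tr].
  by apply: rP => //; rewrite /ball /= sub0r normrN gtr0_norm.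
move=> [r r0 rP]; near=> t; apply: rP; apply/andP; split; near: t.
  exact: nbhs_right_gt.
exact: nbhs_right_lt.
Unshelve. all: by end_near. Qed.

Lemma near_openitv (P : R -> Prop) r t : (forall t, 0 < t < r -> P t) ->
  0 < t < r -> \forall x \near t, P x.
Proof.
move=> rP tr; have : nbhs t `]0, r[%classic.
  by apply: open_nbhs_nbhs; split; [exact: itv_open|rewrite /= in_itv].
by apply: filterS => x; rewrite /= in_itv => /rP.
Qed.

Lemma is_derive_M F H t (a b : R) : is_derive t 1 F a -> is_derive t 1 H b ->
  is_derive t 1 (fun x => F x * H x) (a * H t + F t * b).
Proof. by move=> Fa Hb; rewrite addrC [a * _]mulrC; exact: is_deriveM. Qed.

Lemma cvg_id0 : (t @[t --> 0^'+] --> (0 : R)).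
Proof. by apply: cvg_at_right_filter; exact: cvg_id. Qed.

Lemma right_unique F l l' : F t @[t --> 0^'+] --> l -> F t @[t --> 0^'+] --> l' -> l = l'.
Proof.
move=> Fl Fl'; have := cvg_unique _ Fl Fl'; apply; exact: norm_hausdorff.
Qed.

Lemma limD F H l l' : F t @[t --> 0^'+] --> l -> H t @[t --> 0^'+] --> l' ->
  F t + H t @[t --> 0^'+] --> l + l'.
Proof. by move=> ? ?; exact: cvgD. Qed.

Lemma limB F H l l' : F t @[t --> 0^'+] --> l -> H t @[t --> 0^'+] --> l' ->
  F t - H t @[t --> 0^'+] --> l - l'.
Proof. by move=> ? ?; exact: cvgB. Qed.

Lemma limM F H l l' : F t @[t --> 0^'+] --> l -> H t @[t --> 0^'+] --> l' ->
  F t * H t @[t --> 0^'+] --> l * l'.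
Proof. by move=> ? ?; exact: cvgM. Qed.

(** Functions on a collar line live on t >= 0; the derivatives at 0 are those of
    an extension across 0. *)
Definition twice_diff_at0 F : Prop := exists phi phi1 d r,
  [/\ 0 < r, forall t : R, `|t| < r -> is_derive t 1 phi (phi1 t),
      is_derive (0 : R) 1 phi1 d & forall t, 0 <= t < r -> F t = phi t].

Section Profile.
Variables (n : nat) (gamma : R).
Hypotheses (gamma_gt0 : 0 < gamma) (gamma_lt1 : gamma < 1) (gamma_ltn2 : gamma < n%:R / 2).

Lemma is_derive_quotient F t (d : R) : is_derive t 1 F d ->
  h^-1 * (F (h + t) - F t) @[h --> 0^'+] --> d.
Proof.
move=> [Fd <-]; apply: cvg_dnbhs_at_right.
rewrite (_ : (fun h => _) = (fun h : R => h^-1 *: ((F \o shift t) (h *: (1 : R)) - F t))).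
  exact: Fd.
by apply/funext => h /=; rewrite [h *: _]mulr1.
Qed.

(** phi - q = O(t^n) with n > 1 forces phi and the polynomial q to have the same
    value and derivative at 0, and the derivative of an even polynomial vanishes
    there. *)
Lemma even_derive0 F phi (d r : R) : (1 < n)%N -> 0 < r ->
  (forall t, 0 < t < r -> F t = phi t) ->
  even_expansion n F -> is_derive (0 : R) 1 phi d -> d = 0.
Proof.
move=> n2 r0 Fphi [q [qodd [C qF]]] dphi.
have tn k : (0 < k)%N -> C * t ^+ k @[t --> 0^'+] --> (0 : R).
  move=> k0; rewrite -[X in _ --> X](mulr0 C); apply: cvgM; first exact: cvg_cst.
  have := cvg_at_right_filter (@exprn_continuous R k 0).
  by rewrite expr0n eqn0Ngt k0.
have phic : phi t @[t --> 0^'+] --> phi 0.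
  apply: cvg_at_right_filter; apply: differentiable_continuous.
  by apply/derivable1_diffP; case: dphi.
have qc : q.[t] @[t --> 0^'+] --> q.[0].
  by apply: cvg_at_right_filter; exact: continuous_horner.
have bound : \forall t \near 0^'+, `|phi t - q.[t]| <= C * t ^+ n.
  near=> t; rewrite -Fphi; first by near: t.
  by apply/andP; split; near: t; [exact: nbhs_right_gt|exact: nbhs_right_lt].
have e0 : phi 0 = q.[0].
  have d0 : phi t - q.[t] @[t --> 0^'+] --> (0 : R).
    apply/norm_cvg0P; apply: squeeze_cvgr (cvg_cst 0) (tn n (ltnW n2)).
    by apply: filterS bound => t ->; rewrite normr_ge0.
  have d1 : phi t - q.[t] @[t --> 0^'+] --> phi 0 - q.[0] by exact: cvgB.
  by apply/eqP; rewrite -subr_eq0; apply/eqP; exact: right_unique d1 d0.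
have dq := @is_derive_poly R q 0.
have q1 : (q^`()).[0] = 0.
  by rewrite horner_coef0 coef_deriv qodd// mul0rn.
have l1 := limB _ _ _ _ (is_derive_quotient _ _ _ dphi) (is_derive_quotient _ _ _ dq).
have l2 : (h^-1 * (phi (h + 0) - phi 0) - h^-1 * (q.[h + 0] - q.[0])) @[h --> 0^'+] --> (0 : R).
  apply/norm_cvg0P; have n1 : (0 < n.-1)%N by case: (n) n2 => [|[]].
  apply: squeeze_cvgr (cvg_cst 0) (tn _ n1).
  near=> h; rewrite normr_ge0 /= !addr0 e0.
  have h0 : 0 < h by near: h; exact: nbhs_right_gt.
  rewrite -mulrBr opprB addrA subrK normrM normfV (gtr0_norm h0) ler_pdivrMl//.
  rewrite mulrCA -exprS prednK 1?ltnW//; near: h; exact: bound.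
by have := right_unique _ _ _ l1 l2; rewrite q1 subr0.
Unshelve. all: by end_near. Qed.

Lemma profile F : twice_diff_at0 F -> exists F' : R -> R,
  [/\ \forall t \near 0^'+, is_derive (t : R) 1 F (F' t),
      F t @[t --> 0^'+] --> F 0,
      t * F' t @[t --> 0^'+] --> (0 : R) &
      even_expansion n F -> t `^ (1 - 2 * gamma) * F' t @[t --> 0^'+] --> (0 : R)].
Proof.
move=> [phi [phi1 [d [r [r0 dphi dphi1 Fphi]]]]]; exists phi1.
have dphi0 : is_derive (0 : R) 1 phi (phi1 0) by apply: dphi; rewrite normr0.
have phi1c : phi1 t @[t --> 0^'+] --> phi1 0.
  apply: cvg_at_right_filter; apply: differentiable_continuous.
  by apply/derivable1_diffP; case: dphi1.
split.
- apply/near0P; exists r => // t tr; have /andP[t0 t1] := tr.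
  apply: near_eq_is_derive (dphi t _); last by rewrite gtr0_norm.
  apply: (near_openitv _ r) => // x /andP[x0 xr]; apply/esym/Fphi.
  by rewrite ltW.
- rewrite Fphi ?lexx//; have pc : phi t @[t --> 0^'+] --> phi 0.
    apply: cvg_at_right_filter; apply: differentiable_continuous.
    by apply/derivable1_diffP; case: dphi0.
  apply: cvg_trans pc; apply: near_eq_cvg; apply/near0P; exists r => // t /andP[t0 tr].
  by rewrite Fphi// ltW.
- by rewrite -[X in _ --> X](mul0r (phi1 0)); apply: cvgM phi1c; exact: cvg_id0.
move=> Fev; have [n1|n2] := leqP n 1.
  rewrite -[X in _ --> X](mul0r (phi1 0)); apply: cvgM phi1c.
  apply: powR_cvg0; have : n%:R <= 1 :> R by rewrite (ler_nat R n 1).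
  by move: gamma_ltn2; lra.
have phi10 : phi1 0 = 0.
  apply: (even_derive0 F phi _ r n2 r0 _ Fev dphi0) => t /andP[t0 tr].
  by apply: Fphi; rewrite ltW.
have := is_derive_quotient _ _ _ dphi1; rewrite phi10 => dq.
have p2 : t `^ (2 - 2 * gamma) @[t --> 0^'+] --> (0 : R).
  by apply: powR_cvg0; move: gamma_lt1; lra.
have := limM _ _ _ _ p2 dq; rewrite mul0r => H; apply: cvg_trans H; apply: near_eq_cvg.
apply/near0P; exists 1 => // t /andP[t0 _]; rewrite addr0 subr0 mulrA; congr (_ * _).
rewrite -[t^-1]powR_inv1 ?ltW// -powRD; last by apply/implyP => _; rewrite gt_eqF.
by congr (_ `^ _); ring.
Qed.

(** The weighted derivative of F + H t^(2 gamma) only sees the coefficient H: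
    the derivative of F is bounded, and O(t) when n > 1, so that
    t^(1 - 2 gamma) F' tends to 0; if n = 1 then gamma < 1/2. *)
Lemma singular_profile F H : twice_diff_at0 F -> twice_diff_at0 H ->
  even_expansion n F ->
  let N t := F t + H t * t `^ (2 * gamma) in
  exists N' : R -> R,
  [/\ \forall t \near 0^'+, is_derive (t : R) 1 N (N' t),
      N t @[t --> 0^'+] --> F 0 &
      t `^ (1 - 2 * gamma) * N' t @[t --> 0^'+] --> 2 * gamma * H 0].
Proof.
move=> /profile[F' [dF Fc _ F'c]] /profile[H' [dH Hc tH _]] /F'c{}F'c N.
exists (fun t => F' t + (H' t * t `^ (2 * gamma) + H t * (2 * gamma * t `^ (2 * gamma - 1)))).
have g2 : 0 < 2 * gamma by rewrite mulr_gt0.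
split.
- near=> t; have t0 : 0 < t by near: t; exact: nbhs_right_gt.
  have d1 : is_derive (t : R) 1 F (F' t) by near: t.
  have d2 : is_derive t 1 H (H' t) by near: t.
  exact: (is_deriveD d1 (is_derive_M _ _ _ _ _ d2 (is_derive1_powR (2 * gamma) t0))).
- have -> : F 0 = F 0 + H 0 * 0 by rewrite mulr0 addr0.
  exact (limD _ _ _ _ Fc (limM _ _ _ _ Hc (powR_cvg0 g2))).
- have l1 : 2 * gamma * H t @[t --> 0^'+] --> 2 * gamma * H 0.
    exact (limM _ _ _ _ (cvg_cst (2 * gamma)) Hc).
  have := limD _ _ _ _ (limD _ _ _ _ F'c tH) l1; rewrite !add0r => L; apply: cvg_trans L.
  apply: near_eq_cvg; apply/near0P; exists 1 => // t /andP[t0 _] /=.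
  have tE1 : t `^ (1 - 2 * gamma) * t `^ (2 * gamma) = t.
    rewrite -powRD; last by apply/implyP => _; rewrite gt_eqF.
    by rewrite subrK powRr1// ltW.
  have tE2 : t `^ (1 - 2 * gamma) * t `^ (2 * gamma - 1) = 1.
    rewrite -powRD; last by apply/implyP => _; rewrite gt_eqF.
    by rewrite (_ : _ + _ = 0) ?powRr0//; ring.
  rewrite !mulrDr -addrA; congr (_ + (_ + _)).
    by rewrite [RHS]mulrCA tE1 mulrC.
  by rewrite [RHS]mulrCA [t `^ _ * _]mulrCA tE2 mulr1 mulrC.
Unshelve. all: by end_near. Qed.

Lemma ratio_profile F H F1 H1 : twice_diff_at0 F -> twice_diff_at0 H ->
  twice_diff_at0 F1 -> twice_diff_at0 H1 ->
  even_expansion n F -> even_expansion n F1 -> F1 0 = 1 ->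
  exists U' : R -> R,
  [/\ \forall t \near 0^'+, is_derive (t : R) 1 (fun t =>
        (F t + H t * t `^ (2 * gamma)) / (F1 t + H1 t * t `^ (2 * gamma))) (U' t) &
      t `^ (1 - 2 * gamma) * U' t @[t --> 0^'+] --> 2 * gamma * (H 0 - F 0 * H1 0)].
Proof.
move=> sF sH sF1 sH1 eF eF1 F10.
have [N' [dN Nc N'c]] := singular_profile F H sF sH eF.
have [D' [dD Dc D'c]] := singular_profile F1 H1 sF1 sH1 eF1.
set N := fun t => F t + _ in dN Nc; set D := fun t => F1 t + _ in dD Dc.
rewrite F10 in Dc.
have D0 : \forall t \near 0^'+, 0 < D t by move: Dc => /cvgr_gt; apply.
exists (fun t => N' t * (D t)^-1 + N t * (- D t ^- 2 * D' t)); split.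
  near=> t; have Dt : D t != 0 by rewrite gt_eqF//; near: t.
  have d1 : is_derive t 1 N (N' t) by near: t.
  have d2 : is_derive t 1 D (D' t) by near: t.
  exact: (is_derive_M _ _ _ _ _ d1 (is_deriveV Dt d2)).
have Vc : (D t)^-1 @[t --> 0^'+] --> (1 : R).
  by rewrite -[X in _ --> X]invr1; apply: cvgV => //; exact: oner_neq0.
have L := limB _ _ _ _ (limM _ _ _ _ N'c Vc) (limM _ _ _ _ (limM _ _ _ _ (limM _ _ _ _ Nc Vc) Vc) D'c).
have E : 2 * gamma * H 0 * 1 - F 0 * 1 * 1 * (2 * gamma * H1 0) =
   2 * gamma * (H 0 - F 0 * H1 0) by ring.
rewrite -E; apply: cvg_trans L; apply: near_eq_cvg; near=> t => /=.
rewrite -exprVn -[F t + _]/(N t); ring.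
Unshelve. all: by end_near. Qed.

(** If b (n - s) = 1 then rho = v^b = t D^b on a collar line, and rho is
    asymptotic to t together with its first derivative. *)
Lemma rho_profile F1 H1 (b : R) : twice_diff_at0 F1 -> twice_diff_at0 H1 ->
  even_expansion n F1 -> F1 0 = 1 ->
  let D t := F1 t + H1 t * t `^ (2 * gamma) in
  exists rho' : R -> R,
  [/\ \forall t \near 0^'+, 0 < D t,
      \forall t \near 0^'+, is_derive (t : R) 1 (fun t => t * D t `^ b) (rho' t),
      rho' t @[t --> 0^'+] --> (1 : R) &
      D t `^ b @[t --> 0^'+] --> (1 : R)].
Proof.
move=> sF1 sH1 eF1 F10 D.
have [D' [dD Dc D'c]] := singular_profile F1 H1 sF1 sH1 eF1.
rewrite F10 in Dc.
have D0 : \forall t \near 0^'+, 0 < D t by move: Dc => /cvgr_gt; apply.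
have powc x : D t `^ x @[t --> 0^'+] --> (1 : R).
  suff : D t `^ x @[t --> 0^'+] --> (1 : R) `^ x by rewrite powR1.
  have c1 : {for (1 : R), continuous (fun d : R => d `^ x)}.
    apply: differentiable_continuous; apply/derivable1_diffP.
    by apply: derivable_powR; rewrite in_itv /= ltr01.
  exact: (cvg_comp D (fun d : R => d `^ x) Dc c1).
exists (fun t => 1 * D t `^ b + t * (b * D t `^ (b - 1) * D' t)); split=> //.
  near=> t; have Dt : 0 < D t by near: t.
  have d2 : is_derive t 1 D (D' t) by near: t.
  have d3 := is_derive1_comp (is_derive1_powR b Dt) d2.
  exact: (is_derive_M _ _ _ _ _ (is_derive_id t 1) d3).
have tD' : t * D' t @[t --> 0^'+] --> (0 : R).
  have g2 : 0 < 2 * gamma by rewrite mulr_gt0.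
  have := limM _ _ _ _ (powR_cvg0 g2) D'c; rewrite mul0r => L; apply: cvg_trans L.
  apply: near_eq_cvg; apply/near0P; exists 1 => // t /andP[t0 _] /=.
  have tE : t `^ (2 * gamma) * t `^ (1 - 2 * gamma) = t.
    rewrite -powRD; last by apply/implyP => _; rewrite gt_eqF.
    by rewrite addrC subrK powRr1// ltW.
  by rewrite mulrA tE.
have bc : cst b t @[t --> (0 : R)^'+] --> b by exact: cvg_cst.
have L := limD _ _ _ _ (powc b) (limM _ _ _ _ (limM _ _ _ _ bc (powc (b - 1))) tD').
rewrite mulr0 addr0 in L; apply: cvg_trans L; apply: near_eq_cvg; near=> t => /=.
rewrite mul1r; congr (_ + _); ring.
Unshelve. all: by end_near. Qed.

End Profile.
End Asymptotics.

Section ChangeOfVariable.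
Context {R : realType}.
Variables (rho rho' : R -> R) (t1 : R).
Hypothesis t1_gt0 : 0 < t1.
Hypothesis drho : forall t, 0 < t < t1 -> is_derive t 1 rho (rho' t).
Hypothesis rho'_gt0 : forall t, 0 < t < t1 -> 0 < rho' t.

Lemma rho_incr t t' : 0 < t -> t < t' -> t' < t1 -> rho t < rho t'.
Proof.
move=> t0 tt' t'1.
have d x : t <= x <= t' -> is_derive x 1 rho (rho' x).
  move=> /andP[tx xt]; apply: drho.
  by rewrite (lt_le_trans t0 tx) (le_lt_trans xt t'1).
have [||x] := @MVT R rho rho' t t' tt'.
- by move=> x; rewrite in_itv /= => /andP[tx xt]; apply: d; rewrite !ltW.
- apply: derivable_within_continuous => x; rewrite in_itv /= => xI.
  by have [] := d x xI.
rewrite in_itv /= => /andP[tx xt] E; rewrite -subr_gt0 E mulr_gt0 ?subr_gt0//.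
by apply: rho'_gt0; rewrite (lt_trans t0 tx) (lt_trans xt t'1).
Qed.

Lemma rho_inj t t' : 0 < t < t1 -> 0 < t' < t1 -> rho t = rho t' -> t = t'.
Proof.
move=> /andP[t0 tt] /andP[t'0 tt'] E.
have [lt|lt|//] := ltgtP t t'.
  by have := rho_incr t t' t0 lt tt'; rewrite E ltxx.
by have := rho_incr t' t t'0 lt tt; rewrite E ltxx.
Qed.

Lemma rho_onto r t2 : rho t @[t --> 0^'+] --> (0 : R) -> 0 < r -> 0 < t2 < t1 ->
  r < rho t2 -> exists2 t, 0 < t < t1 & rho t = r.
Proof.
move=> rho0 r0 /andP[t20 t21] rt2.
have : \forall t \near 0^'+, rho t < r by move/cvgr_lt: rho0; apply.
move=> /near0P[q q0 qP].
pose t0 := Num.min q t2 / 2.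
have m0 : 0 < Num.min q t2 by rewrite lt_min q0.
have t00 : 0 < t0 by rewrite divr_gt0.
have : t0 < Num.min q t2 by rewrite ltr_pdivrMr// ltr_pMr// ltr1n.
rewrite lt_min => /andP[t0q t02].
have rt0 : rho t0 < r by apply: qP; rewrite t00.
have [||t] := @IVT R rho t0 t2 r (ltW t02).
- apply: derivable_within_continuous => x; rewrite in_itv /= => /andP[x0 x2].
  have [] // := drho x _; by rewrite (lt_le_trans t00 x0) (le_lt_trans x2).
- have lt : rho t0 <= rho t2 by rewrite ltW// (lt_trans rt0).
  by rewrite (min_idPl lt) (max_idPr lt) !ltW.
rewrite in_itv /= => /andP[tt0 tt2] <-; exists t => //.
by rewrite (lt_le_trans t00 tt0) (le_lt_trans tt2).
Qed.

(** In the coordinate r = rho(t) the derivative of U is U' / rho', and the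
    weights r^a and t^a are equivalent. *)
Lemma change_of_variable (U U' : R -> R) (a l r0 : R) (tau : R -> R) :
  0 < r0 ->
  (forall t, 0 < t < t1 -> is_derive t 1 U (U' t)) ->
  (forall t, 0 < t < t1 -> t / 2 < rho t) ->
  rho' t @[t --> 0^'+] --> (1 : R) ->
  rho t / t @[t --> 0^'+] --> (1 : R) ->
  t `^ a * U' t @[t --> 0^'+] --> l ->
  (forall r, 0 < r < r0 -> 0 < tau r < t1 /\ rho (tau r) = r) ->
  (forall r, 0 < r < r0 -> derivable (U \o tau) r 1) /\
  r `^ a * derive1 (U \o tau) r @[r --> 0^'+] --> l.
Proof.
move=> r00 dU rho2 rho'1 rhot Ul tauP.
have rho_gt0 t : 0 < t < t1 -> 0 < rho t.
  by move=> /[dup] /rho2 h /andP[t0 _]; apply: lt_trans h; rewrite divr_gt0.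
have rhoc t : 0 < t < t1 -> {for t, continuous rho}.
  by move=> /drho[d _]; apply: differentiable_continuous; exact/derivable1_diffP.
have dtau r : 0 < r < r0 -> is_derive r 1 tau (rho' (tau r))^-1.
  move=> /[dup] rI /tauP[tI rE]; rewrite -{1}rE.
  have nI : \forall t \near tau r, 0 < t < t1.
    by apply: near_openitv _ tI.
  apply: is_derive_inverse.
  - have nr : \forall t \near tau r, 0 < rho t < r0.
      near=> t; apply/andP; split.
        by apply: rho_gt0; near: t.
      near: t; have /cvgr_lt := rhoc _ tI; apply.
      by rewrite rE; case/andP: rI.
    near=> t; have tt : 0 < t < t1 by near: t.
    have [tI' E] : 0 < tau (rho t) < t1 /\ rho (tau (rho t)) = rho t.
      by apply: tauP; near: t.
    exact: rho_inj E.
  - by near=> t; apply: rhoc; near: t.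
  - exact: drho.
  - by rewrite gt_eqF// rho'_gt0.
have dW r : 0 < r < r0 -> is_derive r 1 (U \o tau) (U' (tau r) / rho' (tau r)).
  move=> /[dup] rI /tauP[tI _].
  exact: is_derive1_comp (dU _ tI) (dtau _ rI).
split; first by move=> r /dW[].
have tau0 : tau r @[r --> 0^'+] --> (0 : R)^'+.
  move=> P /near0P[e e0 eP]; apply/near0P.
  exists (Num.min r0 (e / 2)); first by rewrite lt_min r00 divr_gt0.
  move=> r /andP[rp]; rewrite lt_min => /andP[rr0 re].
  have [tI rE] : 0 < tau r < t1 /\ rho (tau r) = r by apply: tauP; rewrite rp.
  apply: eP; have /andP[-> _] /= := tI.
  by have := rho2 _ tI; rewrite rE; lra.
have q1 : (rho t / t) `^ a @[t --> 0^'+] --> (1 : R).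
  suff : (rho t / t) `^ a @[t --> 0^'+] --> (1 : R) `^ a by rewrite powR1.
  have c1 : {for (1 : R), continuous (fun d : R => d `^ a)}.
    apply: differentiable_continuous; apply/derivable1_diffP.
    by apply: derivable_powR; rewrite in_itv /= ltr01.
  exact: (cvg_comp (fun t => rho t / t) (fun d : R => d `^ a) rhot c1).
have V1 : (rho' t)^-1 @[t --> 0^'+] --> (1 : R).
  by rewrite -[X in _ --> X]invr1; apply: cvgV => //; exact: oner_neq0.
have L := limM _ _ _ _ (limM _ _ _ _ q1 Ul) V1; rewrite mul1r mulr1 in L.
have := cvg_comp tau _ tau0 L; apply: cvg_trans; apply: near_eq_cvg.
apply/near0P; exists r0 => // r rI; have [tI rE] := tauP _ rI.
have /andP[t0 _] := tI; have /andP[rp _] := rI.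
rewrite /= rE derive1E; have [_ ->] := dW _ rI.
rewrite [RHS]mulrA; congr (_ / _); rewrite mulrA; congr (_ * _).
by rewrite -powRM ?divfK ?gt_eqF// ?ltW// divr_gt0.
Unshelve. all: by end_near. Qed.

End ChangeOfVariable.

(** * The limit on the boundary *)

Section Boundary.
Context {R : realType} {T : topologicalType} {n : nat}.
Variables (A : set (chart R T n.+1)) (M : set T) (g : @bfield R T n).
Variable (gh : @bd_bfield R T n).
Variables (y : T -> R) (delta : R) (c : T -> R -> T).
Hypotheses (hX : compact_manifold A M) (gM : is_metric A (~` M) g).
Hypothesis hy : geodesic_defining A M g gh y delta c.

Let chA e : A e -> is_chart M e.
Proof. by have [_ _ H _ _] := hX; exact: H. Qed.

Let delta_gt0 : 0 < delta.
Proof. by have [] := hy. Qed.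

Lemma ccons_line t (x : 'rV[R]_n) : ccons t x = t *: unitv ord0 + ccons 0 x.
Proof.
have -> : unitv ord0 = @row_mx R 1 1 n 1%:M 0.
  apply/rowP => j; rewrite /unitv !mxE.
  case: (@splitP 1 n j) => k jk; rewrite !mxE.
    by rewrite [k]ord1 !eqxx (_ : j = ord0) ?eqxx//; apply/val_inj; rewrite /= jk [k]ord1.
  by rewrite eqxx (_ : j == ord0 = false)// -val_eqE /= jk.
rewrite /ccons (@scale_row_mx R 1 1 n) (@add_row_mx R 1 1 n) scaler0 add0r.
by rewrite scale_scalar_mx mulr1 -raddfD /= addr0.
Qed.

Lemma collar_twice_diff p eps F : M p -> 0 < eps <= delta ->
  Cr_fun None A (collar M c [set: T] eps) F -> twice_diff_at0 (fun t => F (c p t)).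
Proof.
move=> Mp ed FC; have [k [x kad]] := adapted_ex _ _ _ _ _ _ _ hX hy p Mp.
have [V [Fh [oV Vx VC VF]]] := smooth_extension _ _ _ _ _ _ _ hX hy _ _ _ _ _ Mp kad ed FC.
have [Ak _ kc _] := kad; have /andP[e0 edelta] := ed.
have V2 := class_Cr_ck None 2 _ _ isT VC.
have /nbhs_ballP[r /= r0 rV] : nbhs (ccons 0 x) V by exact: open_nbhs_nbhs.
have u0 : 0 < `|unitv ord0 : 'rV[R]_n.+1| + 1 by rewrite ltr_wpDl.
pose r' := r / (`|unitv ord0 : 'rV[R]_n.+1| + 1).
have lineV (t : R) : `|t| < r' -> V (t *: unitv ord0 + ccons 0 x).
  rewrite ltr_pdivlMr// => tr; apply: rV; rewrite -ball_normE /=.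
  rewrite opprD addrCA subrr addr0 normrN normrZ; apply: le_lt_trans tr.
  by rewrite ler_wpM2l// lerDl.
exists (fun t => Fh (t *: unitv ord0 + ccons 0 x)),
  (fun t => 'D_(unitv ord0) Fh (t *: unitv ord0 + ccons 0 x)),
  ('D_(unitv ord0) ('D_(unitv ord0) Fh) (ccons 0 x)), (Num.min r' eps).
split.
- by rewrite lt_min e0 divr_gt0.
- move=> t; rewrite lt_min => /andP[tr _].
  by apply/is_derive_line/derivableP; apply: ck_derivable V2 (lineV t tr).
- have d := derivableP (ck_derivable _ _ _ _ ord0 (ck_partial _ _ _ ord0 V2) Vx).
  apply/(is_derive_line ('D_(unitv ord0) Fh)).
  by rewrite scale0r add0r.
- move=> t /andP[t0]; rewrite lt_min => /andP[tr te].
  have td : 0 <= t < delta by rewrite t0 (lt_le_trans te).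
  have [kt kE] := kc t td.
  rewrite VF//; first by rewrite kE ccons_line.
    by exists p, t; rewrite t0 te.
  by rewrite kE ccons_line; apply: lineV; rewrite ger0_norm.
Qed.

Lemma collar_open eps : 0 < eps <= delta -> open (collar M c [set: T] eps).
Proof.
move=> /andP[e0 ed]; rewrite openE => q [p [t [Mp _ /andP[t0 te] qE]]].
have [k [x kad]] := adapted_ex _ _ _ _ _ _ _ hX hy p Mp.
have [Ak _ kc _] := kad; have td : 0 <= t < delta by rewrite t0 (lt_le_trans te).
have [kq kE] := kc t td; rewrite -qE in kq kE.
have [[ok _] _ _ _ _] := chA _ Ak.
have nk : nbhs q (cdom k) by exact: open_nbhs_nbhs.
have cc : {for q, continuous ((fun z : 'rV[R]_n.+1 => z 0 ord0) \o cphi k)}.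
  exact: continuous_comp (chart_cont _ _ (chA _ Ak) _ kq) (@coord_continuous _ _ _ _ _ _).
have ne : \forall q' \near q, cphi k q' 0 ord0 < eps.
  by have /cvgr_lt := cc; apply; rewrite /= kE ccons0.
apply: filterS2 nk ne => q' kq'.
have [_ _ _ /(_ _ kq')[p' [t' [Mp' /andP[t'0 _] -> _ ->]]]] := kad => te'.
by exists p', t'; rewrite t'0 te'.
Qed.

(** Away from the boundary a positive continuous function is bounded below, by
    compactness of the complement of a collar. *)
Lemma lower_bound_off_collar (v : T -> R) eps : 0 < eps <= delta ->
  (forall p, ~ M p -> {for p, continuous v}) -> (forall p, ~ M p -> 0 < v p) ->
  exists2 b, 0 < b & forall q, ~ collar M c [set: T] eps q -> b <= v q.
Proof.
move=> ed vc v0; pose Kc := ~` collar M c [set: T] eps.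
have KM q : Kc q -> ~ M q.
  move=> Kq Mq; apply: Kq; exists q, 0; have /andP[e0 _] := ed.
  by rewrite lexx e0 (collar_base _ _ _ _ _ _ _ hy).
have [[q0 Kq0]|K0] := pselect (Kc !=set0); last first.
  by exists 1 => // q Kq; case: K0; exists q.
have [[cT _ _] _ _ _ _] := hX.
have cK : compact Kc.
  apply: (subclosed_compact _ cT) => //.
  exact/open_closedC/collar_open.
have [||q /set_mem Kq qmin] := @compact_EVT_min T R v Kc _ cK.
- by exists q0.
- by apply: continuous_in_subspaceT => q /set_mem/KM; exact: vc.
exists (v q); first exact/v0/KM.
by move=> q' Kq'; apply: qmin; exact/mem_set.
Qed.

Variable gamma : R.
Hypotheses (gamma_gt0 : 0 < gamma) (gamma_lt1 : gamma < 1) (gamma_ltn2 : gamma < n%:R / 2).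
Let s := n%:R / 2 + gamma.
Variables v K : T -> R.
Hypothesis hv : scattering_solution A M g y delta c s (fun=> 1) v K.
Hypothesis v_gt0 : forall p, ~ M p -> 0 < v p.

Lemma interior_continuous u : Cr_fun (Some 2%N) A (~` M) u ->
  forall p, ~ M p -> {for p, continuous u}.
Proof.
move=> uC p Mp; have [_ covA _ _ _] := hX; have [e Ae ep] := covA p.
apply: (chart_continuous _ _ (chA _ Ae) _ _ ep).
apply: ck_cont (Cr_fun_ck _ _ chA _ Ae (Some 2%N) 2 _ isT uC) _.
by exists p.
Qed.

Lemma line_form f u H p : M p -> scattering_solution A M g y delta c s f u H ->
  exists F, [/\ twice_diff_at0 F, twice_diff_at0 (fun t => H (c p t)),
    even_expansion n F, F 0 = f p &
    \forall t \near 0^'+, u (c p t) =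
      t `^ (n%:R - s) * (F t + H (c p t) * t `^ (2 * gamma))].
Proof.
move=> Mp /(scattering_form _ _ _ _ _ _ _ hy _ _ _ _)[F [e [ed FC HC FE uE]]].
have [Fev Ff] := FE p Mp.
exists (fun t => F (c p t)); split=> //.
- exact: collar_twice_diff ed FC.
- exact: collar_twice_diff ed HC.
- by rewrite (collar_base _ _ _ _ _ _ _ hy).
have /andP[e0 edelta] := ed; apply/near0P; exists e => // t /andP[t0 te].
have td : t < delta by exact: lt_le_trans te _.
have Mt : ~ M (c p t) by apply: (collar_interior _ _ _ _ _ _ _ hX hy) => //; rewrite t0.
have [|_ ->//] := uE (c p t) _ Mt; first by exists p, t; rewrite ltW.
by rewrite (collar_y _ _ _ _ _ _ _ hy)// ltW.
Qed.

Lemma ratio_limit f u H p : M p -> scattering_solution A M g y delta c s f u H ->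
  forall U : T -> R, (forall q, ~ M q -> U q = u q / v q) ->
  exists U' : R -> R,
  [/\ \forall t \near 0^'+, is_derive (t : R) 1 (fun t => U (c p t)) (U' t) &
      t `^ (1 - 2 * gamma) * U' t @[t --> 0^'+] --> 2 * gamma * (H p - f p * K p)].
Proof.
move=> Mp hu U UE.
have [F [sF sH eF F0 uE]] := line_form _ _ _ p Mp hu.
have [F1 [sF1 sK eF1 F10 vE]] := line_form _ _ _ p Mp hv.
have [U' [dU U'c]] := ratio_profile n gamma gamma_gt0 gamma_lt1 gamma_ltn2
  _ _ _ _ sF sH sF1 sK eF eF1 F10.
exists U'; split; last first.
  by rewrite -F0; move: U'c; rewrite (collar_base _ _ _ _ _ _ _ hy).
have UN : \forall t \near 0^'+, U (c p t) =
    (F t + H (c p t) * t `^ (2 * gamma)) / (F1 t + K (c p t) * t `^ (2 * gamma)).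
  near=> t; have t0 : 0 < t by near: t; exact: nbhs_right_gt.
  have td : 0 < t < delta by rewrite t0; near: t; exact: nbhs_right_lt.
  rewrite UE; last exact: (collar_interior _ _ _ _ _ _ _ hX hy).
  have -> : u (c p t) = t `^ (n%:R - s) * (F t + H (c p t) * t `^ (2 * gamma)).
    by near: t.
  have -> : v (c p t) = t `^ (n%:R - s) * (F1 t + K (c p t) * t `^ (2 * gamma)).
    by near: t.
  by rewrite -mulf_div divff ?mul1r// gt_eqF// powR_gt0.
move: UN => /near0P[r r0 rU]; move: dU => /near0P[r' r'0 rdU].
apply/near0P; exists (Num.min r r'); first by rewrite lt_min r0.
move=> t /andP[t0]; rewrite lt_min => /andP[tr tr'].
apply: near_eq_is_derive (rdU t _); last by rewrite t0.
by apply: (near_openitv _ r) => [x /rU ->//|]; rewrite t0.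
Unshelve. all: by end_near. Qed.

Section MainLimit.
Variables (rho f u H U : T -> R) (p : T).
Hypothesis Mp : M p.
Hypothesis rhoE : forall q, ~ M q -> rho q = v q `^ (n%:R - s)^-1.
Hypothesis hu : scattering_solution A M g y delta c s f u H.
Hypothesis UE : forall q, ~ M q -> U q = u q / v q.

Lemma along_rho_limit :
  (\forall r \near 0^'+, derivable (along_rho delta c rho U p) r 1) /\
  r `^ (1 - 2 * gamma) * derive1 (along_rho delta c rho U p) r @[r --> 0^'+] -->
    2 * gamma * (H p - f p * K p).
Proof.
pose b : R := (n%:R - s)^-1.
have ns : 0 < n%:R - s by rewrite /s; move: gamma_ltn2; lra.
have b0 : 0 < b by rewrite invr_gt0.
have [U' [dU U'c]] := ratio_limit _ _ _ p Mp hu U UE.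
have [F1 [sF1 sK eF1 F10 vE]] := line_form _ _ _ p Mp hv.
pose D t := F1 t + K (c p t) * t `^ (2 * gamma).
have [rho' [D0 drho rho'c Dbc]] : exists rho' : R -> R,
    [/\ \forall t \near 0^'+, 0 < D t,
        \forall t \near 0^'+, is_derive (t : R) 1 (fun t => t * D t `^ b) (rho' t),
        rho' t @[t --> 0^'+] --> (1 : R) & D t `^ b @[t --> 0^'+] --> (1 : R)].
  exact: (rho_profile n gamma gamma_gt0 gamma_lt1 gamma_ltn2 _ _ b sF1 sK eF1 F10).
have rhoD : \forall t \near 0^'+, rho (c p t) = t * D t `^ b.
  near=> t; have t0 : 0 < t by near: t; exact: nbhs_right_gt.
  have td : 0 < t < delta by rewrite t0; near: t; exact: nbhs_right_lt.
  rewrite rhoE; last exact: (collar_interior _ _ _ _ _ _ _ hX hy).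
  have Dt : 0 < D t by near: t.
  have -> : v (c p t) = t `^ (n%:R - s) * D t by near: t.
  rewrite powRM ?powR_ge0 ?ltW// -powRrM divff ?gt_eqF// powRr1// ltW//.
have : \forall t \near 0^'+, [/\ is_derive (t : R) 1 (fun t => U (c p t)) (U' t),
    is_derive (t : R) 1 (fun t => t * D t `^ b) (rho' t), 0 < rho' t,
    2^-1 < D t `^ b & rho (c p t) = t * D t `^ b].
  have half : (2^-1 : R) < 1 by rewrite invf_lt1// ltr1n.
  near=> t; split; near: t => //; first by move/cvgr_gt: rho'c; apply.
  by move/cvgr_gt: Dbc; apply.
move=> /near0P[t0 t00 t0P].
pose t1 := Num.min t0 delta; have t10 : 0 < t1 by rewrite lt_min t00.
pose rho1 t := rho (c p t).
have t1P t : 0 < t < t1 -> 0 < t < t0.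
  by move=> /andP[-> /lt_le_trans]; apply; rewrite /t1 ge_min lexx.
have t1d : t1 <= delta by rewrite /t1 ge_min lexx orbT.
have drho1 t : 0 < t < t1 -> is_derive t 1 rho1 (rho' t).
  move=> /[dup] tI /t1P/t0P[_ d _ _ _]; apply: near_eq_is_derive d.
  by apply: (near_openitv _ t1) => // x /t1P/t0P[_ _ _ _ E]; rewrite /rho1 E.
have rho'0 t : 0 < t < t1 -> 0 < rho' t by move=> /t1P/t0P[].
have dU1 t : 0 < t < t1 -> is_derive t 1 (fun t => U (c p t)) (U' t).
  by move=> /t1P/t0P[].
have rho2 t : 0 < t < t1 -> t / 2 < rho1 t.
  move=> /[dup] /andP[tp _] /t1P/t0P[_ _ _ half E].
  by rewrite /rho1 E ltr_pM2l.
have rhot : rho1 t / t @[t --> 0^'+] --> (1 : R).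
  apply: cvg_trans Dbc; apply: near_eq_cvg; apply/near0P; exists t1 => // t.
  move=> /[dup] /andP[tp _] /t1P/t0P[_ _ _ _].
  by rewrite /rho1 => ->; rewrite mulrAC divff ?mul1r// gt_eqF.
have rho10 : rho1 t @[t --> 0^'+] --> (0 : R).
  have := limM _ _ _ _ rhot (@cvg_id0 R); rewrite mulr0.
  apply: cvg_trans; apply: near_eq_cvg; apply/near0P; exists t1 => // t /andP[tp _].
  by rewrite divfK// gt_eqF.
have t1ed : 0 < t1 <= delta by rewrite t10.
have [vC _ _] := hv.
have [m m0 mv] := lower_bound_off_collar v t1 t1ed (interior_continuous v vC) v_gt0.
pose t2 := t1 / 2.
have t2I : 0 < t2 < t1 by rewrite divr_gt0//= ltr_pdivrMr// ltr_pMr// ltr1n.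
pose r0 := Num.min (m `^ b) (rho1 t2).
have r00 : 0 < r0.
  rewrite lt_min powR_gt0//=; apply: lt_trans (rho2 _ t2I).
  by rewrite divr_gt0//; case/andP: t2I.
pose tau r := y (rho_point delta c rho p r).
(* Since rho is bounded below off the collar, a point of the line through p at
   which rho takes a small value has a small parameter. *)
have tauP r : 0 < r < r0 ->
    [/\ 0 < tau r < t1, rho1 (tau r) = r & rho_point delta c rho p r = c p (tau r)].
  move=> /andP[rp]; rewrite lt_min => /andP[rm rt2].
  have [t /andP[tp tt1] tr] := rho_onto _ _ _ drho1 r t2 rho10 rp t2I rt2.
  have ex : exists q, [set q | exists2 t, 0 < t < delta & q = c p t /\ rho q = r] q.
    by exists (c p t); exists t => //; rewrite tp (lt_le_trans tt1).
  have [t' /andP[t'p t'd] [qE qr]] := xgetPex p ex.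
  have tauE : tau r = t'.
    by rewrite /tau /rho_point qE (collar_y _ _ _ _ _ _ _ hy)// ltW.
  rewrite tauE /rho1 -qE; split=> //; rewrite t'p /= ltNge; apply/negP => t1t'.
  have off : ~ collar M c [set: T] t1 (c p t').
    move=> [p' [t'' [Mp' _ /andP[t''0 t''1] E]]].
    have := collar_y _ _ _ _ _ _ _ hy p t' Mp.
    rewrite E (collar_y _ _ _ _ _ _ _ hy)//; last by rewrite t''0 (lt_le_trans t''1).
    rewrite (ltW t'p) t'd => /(_ isT) E'; move: t1t'; rewrite -E' leNgt.
    by rewrite t''1.
  have Mt' : ~ M (c p t') by apply: (collar_interior _ _ _ _ _ _ _ hX hy) => //; rewrite t'p.
  have : m `^ b <= rho (c p t').
    rewrite rhoE//; apply: (ge0_ler_powR (ltW b0)) (mv _ off).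
      by rewrite nnegrE ltW.
    by rewrite nnegrE ltW// v_gt0.
  by rewrite -qE qr leNgt rm.
have [dW Wc] := change_of_variable rho1 rho' t1 drho1 rho'0 _ U'
  (1 - 2 * gamma) _ r0 tau r00 dU1 rho2 rho'c rhot U'c (fun r rI => let: And3 a1 a2 _ := tauP r rI in conj a1 a2).
have alongE r : 0 < r < r0 ->
    {near r, ((fun t => U (c p t)) \o tau) =1 along_rho delta c rho U p}.
  move=> rI; apply: (near_openitv _ r0) => // x /tauP[_ _].
  by rewrite /along_rho => ->.
split.
  apply/near0P; exists r0 => // r rI.
  exact: near_eq_derivable (alongE r rI) (dW r rI).
apply: cvg_trans Wc; apply: near_eq_cvg; apply/near0P; exists r0 => // r rI.
by rewrite !derive1E (near_eq_derive _ (alongE r rI)).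
Unshelve. all: by end_near. Qed.

End MainLimit.

(** Applied to the quotient of two solutions with boundary value 1, which is
    constant, the limit shows that the coefficient H does not depend on the
    solution. *)
Lemma scattering_unique v' K' p : M p ->
  scattering_solution A M g y delta c s (fun=> 1) v' K' -> K' p = K p.
Proof.
move=> Mp hv'.
have M0 : M !=set0 by exists p.
have c1 : Cr_fun (Some 2%N) A (~` M) (fun=> 1 : R).
  move=> e Ae z Dz; exists setT, (fun=> 1).
  split=> //; first exact: openT.
  have cstE l : exists a : R, iter_partial l (fun=> 1 : R) = (fun=> a) :> ('rV[R]_n.+1 -> R).
    elim: l => [|i l [a IH]]; first by exists 1.
    exists 0; apply/funext => w; rewrite /= -/(iter_partial l _) IH.
    exact: derive_cst.
  move=> l _ w _; have [a ->] := cstE l; split; first exact: cst_continuous.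
  by move=> _ i; exact: derivable_cst.
have cc : continuous (fun _ : T => 1 : R) by move=> q; exact: cst_continuous.
have E := extension_ratio _ _ _ _ _ _ _ hX gM hy _ gamma_gt0 _ _ hv v_gt0 _ _ _ hv'
  (fun=> 1) M0 c1 cc (weighted_harmonic_cst _ _ _ _ 1) (fun _ _ => erefl).
have [U' [dU U'c]] := ratio_limit _ _ _ p Mp hv' (fun=> 1) E.
have U0 : \forall t \near 0^'+, 0 = t `^ (1 - 2 * gamma) * U' t.
  apply: filterS dU => t [_ <-]; by rewrite (derive_cst (1 : R)) mulr0.
have l0 : t `^ (1 - 2 * gamma) * U' t @[t --> (0 : R)^'+] --> (0 : R).
  have z : cst (0 : R) t @[t --> (0 : R)^'+] --> (0 : R) by exact: cvg_cst.
  by apply: cvg_trans z; apply: near_eq_cvg; apply: filterS U0 => t <-.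
have /eqP := right_unique _ _ _ U'c l0.
by rewrite mul1r !mulf_eq0 pnatr_eq0 (gt_eqF gamma_gt0) /= subr_eq0 => /eqP.
Qed.

End Boundary.

Theorem theorem4p7 (R : realType) (n : nat) (T : topologicalType)
    (A : set (chart R T n.+1)) (M : set T) (g : @bfield R T n)
    (gh : @bd_bfield R T n)
    (hX : compact_manifold A M)
    (hg : conformally_compact_einstein A M g gh)
    (hspec : no_small_eigenvalue A M g)
    (y : T -> R) (delta : R) (c : T -> R -> T)
    (hy : geodesic_defining A M g gh y delta c)
    (gamma : R) (gamma_gt0 : 0 < gamma) (gamma_lt1 : gamma < 1)
    (gamma_ltn2 : gamma < n%:R / 2)
    (a : R) (ha : a = 1 - 2 * gamma)
    (rho : T -> R)
    (hrho : special_defining A M g y delta c gamma rho)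
    (f : T -> R) (hf : Cr_fun None (bd_atlas A M) M f)
    (U : T -> R) (hU : extension_solution A M g rho a f U)
    (Pf Q : T -> R)
    (hP : is_P A M g y delta c gamma f Pf)
    (hQ : is_Q A M g y delta c gamma Q) :
  exists L : T -> R, forall p, M p ->
    [/\ \forall r \near 0^'+, derivable (along_rho delta c rho U p) r 1,
        (fun r => r `^ a * derive1 (along_rho delta c rho U p) r) @ 0^'+ --> L p &
        Pf p = d_ gamma / (2 * gamma) * L p + f p * Q p].
Proof.
have [gM _ _ _] := hg.
have [v [K [hv v_gt0 rhoE]]] := hrho.
have chA e : A e -> is_chart M e by have [_ _ H _ _] := hX; exact: H.
have [Sf [u [H [hu SfE]]] PfE] := hP.
have [Sq [v' [K' [hv' SqE]]] QE] := hQ.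
have [UC Uc Ueq Uf] := hU.
have Uh : weighted_harmonic A M g v U.
  move=> e z Ae Dz; have [ez Mz _] := imageP _ _ (chA _ Ae) _ Dz.
  have := Ueq e _ Ae ez Mz.
  rewrite (conformal_divg _ _ _ chA gM _ Ae _ _ _ _ _ _ gamma_ltn2 ha v_gt0 rhoE Dz).
  move/eqP; rewrite oppr_eq0 mulf_eq0 invr_eq0 => /orP[|/eqP//].
  rewrite gt_eqF// sqrtr_gt0; apply: posdef_det; apply: posdef_scale.
    by rewrite exprn_gt0// rhoE// powR_gt0// v_gt0.
  exact: (metric_posdef _ _ _ chA gM _ Ae).
exists (fun p => 2 * gamma * (H p - f p * K p)) => p Mp.
have M0 : M !=set0 by exists p.
have UE := extension_ratio _ _ _ _ _ _ _ hX gM hy _ gamma_gt0 _ _ hv v_gt0 _ _ _ hu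
  _ M0 UC Uc Uh Uf.
have [dL cL] := along_rho_limit _ _ _ _ _ _ _ hX hy _ gamma_gt0 gamma_lt1
  gamma_ltn2 _ _ hv v_gt0 _ _ _ _ _ p Mp rhoE hu UE.
split=> //; first by rewrite ha.
have KE := scattering_unique _ _ _ _ _ _ _ hX gM hy _ gamma_gt0 gamma_lt1
  gamma_ltn2 _ _ hv v_gt0 _ _ p Mp hv'.
rewrite PfE// SfE// QE// SqE// KE.
by field; rewrite gt_eqF.
Qed.
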